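(* For any two distinct points $p,q\in\mathbb{R}^N$ there exists a curve $\gamma_*\in Lip_{\mathfrak{Z}}(p,q)$ satisfying $$L(\gamma_* )=\inf_{\gamma\in Lip_{\mathfrak{Z}}(p,q)}L(\gamma)=d(p,q)=E(\gamma_* ).$$
   Context: Let $N\ge 2$, $m\ge 2$, and let $W:\mathbb{R}^N\to[0,\infty)$ be a continuous function such that: (i) its zero set is $\mathfrak{Z}=\{\mathbf{p}_1,\dots,\mathbf{p}_m\}$, consisting of $m$ distinct points, and $W>0$ elsewhere; (ii) $\liminf_{|p|\to\infty}W(p)>0$. Set $F:=\sqrt{W}$. For a continuous curve $\gamma:[0,1]\to\mathbb{R}^N$ put $\mathcal{T}_\gamma:=\{t\in[0,1]:\gamma(t)\in\mathfrak{Z}\}$. The class $Lip_{\mathfrak{Z}}([0,1];\mathbb{R}^N)$ consists of all continuous $\gamma:[0,1]\to\mathbb{R}^N$ that are locally Lipschitz (Euclidean metric) on $[0,1]\setminus\mathcal{T}_\gamma$. For $p,q\in\mathbb{R}^N$, $Lip_{\mathfrak{Z}}(p,q)$ is the set of $\gamma\in Lip_{\mathfrak{Z}}([0,1];\mathbb{R}^N)$ with $\gamma(0)=p$, $\gamma(1)=q$. For $\gamma\in Lip_{\mathfrak{Z}}([0,1];\mathbb{R}^N)$ define $E(\gamma):=\int_0^1F(\gamma(t))|\gamma'(t)|\,dt\in[0,\infty]$, where the integrand is taken to be $0$ at times $t\in\mathcal{T}_\gamma$ (where $F(\gamma(t))=0$). The metric $d$ on $\mathbb{R}^N$ is $d(p,q):=\inf\{E(\gamma):\gamma\in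 Lip_{\mathfrak{Z}}(p,q)\}$. The length of a curve $\gamma:[0,1]\to\mathbb{R}^N$ is $$L(\gamma):=\sup\sum_{j=0}^{J-1}d(\gamma(t_j),\gamma(t_{j+1}))\in[0,\infty],$$ the supremum being over all finite partitions $0=t_0<t_1<\dots<t_J=1$ of $[0,1]$. *)

(* Defs.v *)
From HB Require Import structures.
From mathcomp Require Import all_boot all_order all_algebra.
From mathcomp Require Import all_classical all_reals all_analysis.

Set Implicit Arguments.
Unset Strict Implicit.
Unset Printing Implicit Defensive.

Import Order.TTheory GRing.Theory Num.Theory.
Import numFieldNormedType.Exports.

Local Open Scope classical_set_scope.
Local Open Scope ring_scope.

Section WeightedMetric.
Context {R : realType} {N : nat}.
Implicit Types (W : 'rV[R]_N -> R) (gamma : R -> 'rV[R]_N) (p q : 'rV[R]_N).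

(* The library norm on 'rV[R]_N is the sup norm. It induces the Euclidean
   topology, so continuity and derivatives are the library's; only metric
   quantities use [enorm]. *)
Definition enorm (v : 'rV[R]_N) : R := Num.sqrt (\sum_(i < N) v ord0 i ^+ 2).

(* Filter of neighbourhoods of infinity, i.e. |x| -> +oo. *)
Definition at_infinity : set_system 'rV[R]_N :=
  [set A | exists M : R, forall x, M < enorm x -> A x].

Definition zero_set W : set 'rV[R]_N := [set x | W x = 0].

(* Curves on [0, 1] are total functions on R; nothing below depends on their
   values outside [0, 1], except [derive1 gamma] at the two endpoints, which
   form a null set. *)
Definition zero_times W gamma : set R :=
  [set t | t \in `[0, 1] /\ zero_set W (gamma t)].

Definition locally_elipschitz (A : set R) gamma : Prop :=
  forall t, A t -> exists2 e : R, 0 < e & exists k : R,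
    forall s s', A s -> A s' -> `|s - t| < e -> `|s' - t| < e ->
      enorm (gamma s - gamma s') <= k * `|s - s'|.

Definition LipZ W : set (R -> 'rV[R]_N) :=
  [set gamma : R -> 'rV[R]_N | {within `[0 : R, 1], continuous gamma} /\
     locally_elipschitz ([set` `[0, 1]] `\` zero_times W gamma) gamma].

Definition LipZ_from_to W p q : set (R -> 'rV[R]_N) :=
  [set gamma | [/\ LipZ W gamma, gamma 0 = p & gamma 1 = q]].

(* [derive1 gamma] is total: at [zero_times] the factor [Num.sqrt (W (gamma t))]
   makes the integrand 0 whatever its value, and the other times where a
   curve of [LipZ W] is not differentiable are negligible (Rademacher). *)
Definition energy W gamma : \bar R :=
  (\int[@lebesgue_measure R]_(t in `[0%R, 1%R])
     (Num.sqrt (W (gamma t)) * enorm (derive1 gamma t))%:E)%E.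

Definition wdist W p q : \bar R :=
  ereal_inf [set energy W gamma | gamma in LipZ_from_to W p q].

(* As in the library's [variation], a partition 0 = t_0 < t_1 < ... < t_J = 1
   is the sequence s = [:: t_1; ...; t_J]. *)
Definition partition_sum W gamma (s : seq R) : \bar R :=
  let t := nth 1 (0 :: s) in
  (\sum_(0 <= j < size s) wdist W (gamma (t j)) (gamma (t j.+1)))%E.

Definition curve_length W gamma : \bar R :=
  ereal_sup [set partition_sum W gamma s | s in itv_partition 0 1].

End WeightedMetric.

(* Main.v *)
Require Import Defs.
From HB Require Import structures.
From mathcomp Require Import all_boot all_order all_algebra.
From mathcomp Require Import all_classical all_reals all_analysis.
From mathcomp Require Import measurable_realfun.
From mathcomp Require Import ring lra.

Set Implicit Arguments.
Unset Strict Implicit.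
Unset Printing Implicit Defensive.

Import Order.TTheory GRing.Theory Num.Theory.
Import numFieldNormedType.Exports.

Local Open Scope classical_set_scope.
Local Open Scope ring_scope.

(** Write F for the square root of W, E for [energy], L for [curve_length] and d
for [wdist]; [dist] is the real number behind d.

Every admissible curve g from p to q satisfies d(p, q) <= L(g) <= E(g). The
first inequality is the partition with the single piece [0, 1]. For the second
one, freezing g outside [a, b] gives a competitor for the distance from g a to
g b whose energy is the part of E(g) carried by [a, b] ([wdist_le_arc]), and
these parts add up ([curve_length_le_energy]). Hence inf L = d(p, q)
([inf_curve_length]), and everything follows once some curve h has
E(h) = d(p, q): its length is squeezed between d(p, q) and E(h).

Put l = d(p, q). The curve h is obtained as one with d(h s, h t) <= l |s - t|
([geodesic]). On a curve g of energy less than l + e the intermediate value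
theorem provides, for each t in [0, 1], a point h t with d(p, h t) = l t.
Cutting g at two of these points, in whichever order it meets them, and
bounding the two outer arcs from below by distances leaves at most
l |s - t| + e for the arc between them ([almost_geodesic]). Since W stays away
from 0 at infinity, sets that are bounded for d are bounded
([dist_bounded]), so the points h t stay in a compact set and converge along
an ultrafilter as e tends to 0.

Such an h minimizes the energy. Where F >= c on a ball, d dominates c times
the Euclidean distance ([dist_lower_bound]). Off the wells h is therefore
locally Lipschitz, and F(h t) |h'(t)| <= l wherever h is differentiable
([dist_lipschitz_integrand]); integrating, E(h) <= l. At a well continuity of
h still holds, because a curve that leaves the well has to cross an annulus on
which F is bounded below ([dist_separates]).

The lower bound on d rests on the inequality
c |g b - g a| <= \int_a^b F(g) |g'| for curves on which F >= c
([enorm_le_arc]), and this one on the fundamental theorem of calculus for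
Lipschitz functions ([lipschitz_ftc]): such a function is, up to an affine
change, nondecreasing with a Stieltjes measure bounded by Lebesgue measure, so
it is the integral of a Radon-Nikodym density, and the Lebesgue
differentiation theorem identifies the density with the derivative. *)

(** * The Euclidean norm *)

Section EuclideanNorm.
Context {R : realType} {N : nat}.
Implicit Types u v w x y z : 'rV[R]_N.

Definition dot u v : R := \sum_(i < N) u ord0 i * v ord0 i.

Lemma enorm_ge0 v : 0 <= enorm v.
Proof. exact: sqrtr_ge0. Qed.

Lemma sqr_enorm v : enorm v ^+ 2 = dot v v.
Proof.
rewrite /enorm sqr_sqrtr; last by apply: sumr_ge0 => i _; exact: sqr_ge0.
by apply: eq_bigr => i _; rewrite expr2.
Qed.

Lemma enormZ (a : R) v : enorm (a *: v) = `|a| * enorm v.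
Proof.
apply/eqP; rewrite -(@eqrXn2 _ 2) ?mulr_ge0 ?enorm_ge0 ?normr_ge0//.
rewrite exprMn !sqr_enorm real_normK ?num_real// /dot mulr_sumr; apply/eqP.
by apply: eq_bigr => i _; rewrite mxE; ring.
Qed.

Lemma enorm0 : enorm (0 : 'rV[R]_N) = 0.
Proof. by rewrite -(scale0r 0) enormZ normr0 mul0r. Qed.

Lemma enormN v : enorm (- v) = enorm v.
Proof. by rewrite -scaleN1r enormZ normrN1 mul1r. Qed.

Lemma enormBC u v : enorm (u - v) = enorm (v - u).
Proof. by rewrite -enormN opprB. Qed.

Lemma coord_le_enorm v i : `|v ord0 i| <= enorm v.
Proof.
rewrite -ler_sqr ?nnegrE ?enorm_ge0 ?normr_ge0// real_normK ?num_real//.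
rewrite sqr_enorm /dot (bigD1 i)//= -expr2 lerDl.
by apply: sumr_ge0 => j _; rewrite -expr2 sqr_ge0.
Qed.

Lemma enorm_eq0 v : enorm v = 0 -> v = 0.
Proof.
move=> v0; apply/rowP => i; rewrite mxE; apply/eqP.
by rewrite -normr_le0 -v0 coord_le_enorm.
Qed.

Lemma cauchy_schwarz u v : dot u v <= enorm u * enorm v.
Proof.
have [/eqP|u0] := eqVneq (enorm u) 0.
  move=> /eqP/enorm_eq0 ->; rewrite enorm0 mul0r /dot big1// => i _.
  by rewrite mxE mul0r.
have [/eqP|v0] := eqVneq (enorm v) 0.
  move=> /eqP/enorm_eq0 ->; rewrite enorm0 mulr0 /dot big1// => i _.
  by rewrite mxE mulr0.
have ab : 0 < enorm u * enorm v by rewrite mulr_gt0// lt0r ?u0 ?v0 enorm_ge0.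
have : 0 <= \sum_(i < N) (enorm v * u ord0 i - enorm u * v ord0 i) ^+ 2.
  by apply: sumr_ge0 => i _; exact: sqr_ge0.
rewrite (_ : \sum_(i < N) _ = enorm v ^+ 2 * dot u u
   + enorm u ^+ 2 * dot v v - 2 * (enorm u * enorm v) * dot u v); last first.
  rewrite /dot !mulr_sumr -big_split -sumrB/=; apply: eq_bigr => i _; ring.
rewrite -!sqr_enorm.
rewrite (_ : _ - _ = (2 * (enorm u * enorm v)) * (enorm u * enorm v - dot u v)).
  by rewrite pmulr_rge0 ?subr_ge0// mulr_gt0.
ring.
Qed.

Lemma cauchy_schwarz_abs u v : `|dot u v| <= enorm u * enorm v.
Proof.
rewrite ler_norml cauchy_schwarz andbT lerNl.
have -> : - dot u v = dot (- u) v.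
  by rewrite /dot -sumrN; apply: eq_bigr => i _; rewrite mxE mulNr.
by rewrite -(enormN u) cauchy_schwarz.
Qed.

Lemma enormD u v : enorm (u + v) <= enorm u + enorm v.
Proof.
rewrite -ler_sqr ?nnegrE ?addr_ge0 ?enorm_ge0//.
rewrite sqr_enorm (_ : dot _ _ = dot u u + 2 * dot u v + dot v v); last first.
  rewrite /dot mulr_sumr -!big_split/=.
  by apply: eq_bigr => i _; rewrite !mxE; ring.
have := cauchy_schwarz u v; rewrite -!sqr_enorm; nra.
Qed.

Lemma enorm_distD w u v : enorm (u - v) <= enorm (u - w) + enorm (w - v).
Proof. by rewrite -[u - v](subrKA w) enormD. Qed.

Lemma mx_norm_le_enorm v : `|v| <= enorm v.
Proof.
rewrite [leLHS]/Num.norm/= mx_normrE; apply: bigmax_le; first exact: enorm_ge0.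
by move=> [i j] _ /=; rewrite (ord1 i) coord_le_enorm.
Qed.

Lemma enorm_le_mx_norm v : enorm v <= N%:R * `|v|.
Proof.
rewrite -ler_sqr ?nnegrE ?mulr_ge0 ?enorm_ge0//.
have -> : enorm v ^+ 2 <= (N%:R * `|v|) ^+ 2 = (enorm v ^+ 2 <= N%:R * (N%:R * `|v| ^+ 2)).
  by congr (_ <= _); ring.
apply: (@le_trans _ _ (N%:R * `|v| ^+ 2)).
  rewrite sqr_enorm /dot mulr_natl.
  rewrite -[X in _ *+ X]card_ord -sumr_const.
  apply: ler_sum => i _; rewrite -expr2 -real_normK ?num_real//.
  rewrite lerXn2r ?nnegrE ?normr_ge0//.
  rewrite [leRHS]/Num.norm/= mx_normrE.
  by apply: (@le_bigmax _ _ _ _ (fun ij => `|v ij.1 ij.2|) (ord0, i)).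
have [->|N0] := eqVneq (N%:R : R) 0; first by rewrite !mul0r.
rewrite ler_peMl ?mulr_ge0 ?exprn_ge0// ler1n lt0n.
by apply: contra_neq N0 => ->.
Qed.

Lemma enorm_lip u v : `|enorm u - enorm v| <= enorm (u - v).
Proof.
rewrite ler_norml lerNl opprB !lerBlDr; apply/andP; split.
  by rewrite enormBC -{1}[v](subrK u) enormD.
by rewrite -{1}[u](subrK v) enormD.
Qed.

(** The topology is that of the sup norm; as the two norms are equivalent,
    neighbourhoods can from here on be described with [enorm]. *)
Lemma nbhs_enormP (x : 'rV[R]_N) (A : set 'rV[R]_N) :
  nbhs x A <-> exists2 e : R, 0 < e & forall y : 'rV[R]_N, enorm (x - y) < e -> A y.
Proof.
split=> [/nbhs_ballP[e /= e0 xeA]|[e e0 xeA]].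
  exists e => // y xy; apply: xeA; rewrite mx_norm_ball /ball_/=.
  exact: le_lt_trans (mx_norm_le_enorm _) xy.
have N1 : 0 < N%:R + 1 :> R by rewrite ltr_wpDl.
apply/nbhs_ballP; exists (e / (N%:R + 1)); first by rewrite /= divr_gt0.
move=> y; rewrite mx_norm_ball /ball_/= ltr_pdivlMr// => xy.
apply: xeA; apply: le_lt_trans (enorm_le_mx_norm _) _; apply: le_lt_trans xy.
by rewrite mulrC ler_wpM2l// lerDl.
Qed.

Lemma enorm_continuous : continuous (@enorm R N).
Proof.
move=> x; apply/(@cvgrPdist_lt _ R^o _ (nbhs x)) => e e0.
apply/nbhs_enormP; exists e => // y; exact/le_lt_trans/enorm_lip.
Qed.

Lemma enorm_sub_continuous (x : 'rV[R]_N) : continuous (fun z => enorm (x - z)).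
Proof.
move=> z; apply/(@cvgrPdist_lt _ R^o _ (nbhs z)) => e e0.
apply/nbhs_enormP; exists e => // y zy; apply: le_lt_trans zy.
apply: le_trans (enorm_lip _ _) _.
by rewrite opprB addrC addrA subrK enormBC.
Qed.

Lemma enorm_ball_closed (x : 'rV[R]_N) (r : R) : closed [set z | enorm (x - z) <= r].
Proof.
apply: (@closed_comp _ _ (fun z => enorm (x - z)) [set s | s <= r]).
  by move=> z _; exact: enorm_sub_continuous.
exact: closed_le.
Qed.

Lemma enorm_coball_closed (x : 'rV[R]_N) (r : R) : closed [set z | r <= enorm (x - z)].
Proof.
apply: (@closed_comp _ _ (fun z => enorm (x - z)) [set s | r <= s]).
  by move=> z _; exact: enorm_sub_continuous.
exact: closed_ge.
Qed.

Lemma enorm_closed_ball_compact (x : 'rV[R]_N) (r : R) : compact [set z | enorm (x - z) <= r].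
Proof.
apply: bounded_closed_compact; last first.
  exact: enorm_ball_closed.
exists (enorm x + r); split; first exact: num_real.
move=> M xrM z /= xzr; apply: le_trans (mx_norm_le_enorm _) _.
have := enorm_distD x z 0; rewrite !subr0 (enormBC z x); lra.
Qed.

End EuclideanNorm.

(** * Preliminaries on the real line *)

Section RealLine.
Context {R : realType}.
Implicit Types (a b d k t : R).

Lemma exists_invS_lt (d : R) : 0 < d -> exists n, n.+1%:R^-1 < d.
Proof.
move=> d0; exists (Num.trunc d^-1).
by rewrite -[ltRHS]invrK ltf_pV2 ?posrE ?invr_gt0// truncnS_gt.
Qed.

Lemma near_itv a b t : a < t < b -> \near t, a < t < b.
Proof.
move=> /andP[at_ tb]; near=> s.
by apply/andP; split; near: s; [exact: lt_nbhsr|exact: lt_nbhsl].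
Unshelve. all: by end_near. Qed.

Lemma lipschitz_continuous (p : R -> R) k :
  (forall s s', `|p s - p s'| <= k * `|s - s'|) -> continuous p.
Proof.
move=> pk t; apply/cvgrPdist_lt => e e0.
near=> s; apply: le_lt_trans (pk _ _) _.
apply: (@le_lt_trans _ _ ((`|k| + 1) * `|t - s|)).
  by rewrite ler_wpM2r// (le_trans (ler_norm _))// lerDl.
rewrite mulrC -ltr_pdivlMr; last by rewrite ltr_wpDl.
by near: s; apply: cvgr_dist_lt => //; rewrite divr_gt0// ltr_wpDl.
Unshelve. all: by end_near. Qed.

(** The retraction of the line onto [[a, b]]. Precomposing with it restricts
    a curve to [[a, b]] without any change of time scale. *)
Definition clamp a b t : R := Num.max a (Num.min b t).

Lemma clamp_id a b t : a <= t <= b -> clamp a b t = t.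
Proof. by move=> /andP[at_ tb]; rewrite /clamp min_r// max_r. Qed.

Lemma clamp_left a b t : a <= b -> t <= a -> clamp a b t = a.
Proof.
by move=> ab ta; rewrite /clamp max_l// ge_min ta orbT.
Qed.

Lemma clamp_right a b t : a <= b -> b <= t -> clamp a b t = b.
Proof. by move=> ab bt; rewrite /clamp min_l// max_r. Qed.

Lemma clamp_itv a b t : a <= b -> a <= clamp a b t <= b.
Proof. by move=> ab; rewrite /clamp le_max lexx ge_max ab ge_min lexx. Qed.

(** The supremum of the points that can be reached from [a] can itself be
    reached, and it can be passed unless it is [b]. *)
Lemma cousin_chain (P : R -> R -> Prop) a b : a <= b ->
  (forall u v w : R, a <= u -> u <= v -> v <= w -> w <= b -> P u v -> P v w -> P u w) ->
  (forall t, a <= t <= b -> exists2 e : R, 0 < e &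
    forall u v : R, a <= u -> v <= b -> t - e < u -> u <= t -> t <= v -> v < t + e -> P u v) ->
  P a b.
Proof.
move=> ab Ptrans Ploc.
pose S := [set x | a <= x <= b /\ P a x].
have Sa : S a.
  split; first by rewrite lexx.
  have [e e0 eP] := Ploc a (introT andP (conj (lexx a) ab)).
  by apply: eP => //; lra.
have Sb : has_ubound S by exists b => x [/andP[]].
have supS : has_sup S by split; [exists a|].
pose s := sup S.
have as_ : a <= s by apply: ub_le_sup.
have sb : s <= b by apply: ge_sup => [|x [/andP[]]//]; exists a.
have [e e0 eP] := Ploc s (introT andP (conj as_ sb)).
have [x [/andP[ax xb] Pax] sx] := sup_adherent e0 supS.
have xs : x <= s by apply: ub_le_sup => //; split=> //; apply/andP.
pose s' := Num.min b (s + e / 2).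
have ss' : s <= s' by rewrite le_min sb lerDl divr_ge0// ltW.
have s'b : s' <= b by rewrite ge_min lexx.
have Pas' : P a s'.
  apply: (Ptrans _ x) => //; first exact: le_trans ss'.
  apply: eP => //.
  by rewrite /s' gt_min ltrD2l gtr_pMr// invf_lt1// ltr1n orbT.
have Ss' : S s' by split=> //; rewrite (le_trans as_ ss').
have s's : s' <= s by apply: ub_le_sup.
have bs : b = s'.
  rewrite /s'; case: leP => // sb'; exfalso.
  by move: s's; rewrite /s' min_r ?(ltW sb')// => ?; lra.
by rewrite bs.
Qed.

(** The time is the minimum of the compact set where [r <= f]; the
    intermediate value theorem shows that the value there is exactly [r]. *)
Lemma first_hit (f : R -> R) (r : R) : continuous f -> f 0 <= r -> r <= f 1 ->
  exists t, [/\ 0 <= t <= 1, f t = r & forall s, 0 <= s <= t -> f s <= r].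
Proof.
move=> cf f0 f1.
pose A := `[0, 1]%classic `&` f @^-1` [set x | r <= x].
have A1 : A 1 by split; rewrite //= in_itv/= ler01 lexx.
have cA : compact A.
  apply: (subclosed_compact _ (@segment_compact _ 0 1)); last by move=> ? [].
  apply: closedI; first exact: itv_closed.
  by apply: closed_comp => [x _|]; [exact: cf|exact: closed_ge].
have [t tA tmin] : exists2 t, t \in A & forall s, s \in A -> t <= s.
  apply: (@compact_EVT_min _ _ (@idfun R) A) => //; first by exists 1.
  by apply: continuous_subspaceT => x; exact: cvg_id.
move: (tA); rewrite inE => -[/=]; rewrite in_itv/= => /andP[t0 t1] rt.
have [u] : exists2 u, u \in `[0, t] & f u = r.
  apply: IVT => //; first exact: continuous_subspaceT.
  by rewrite ge_min f0 le_max rt orbT.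
rewrite in_itv/= => /andP[u0 ut] fu.
have tu : t <= u.
  by apply: tmin; rewrite inE; split; rewrite /= ?in_itv/= ?fu ?u0 ?(le_trans ut)//.
have ? : u = t by apply/le_anti; rewrite ut.
subst u; exists t; split=> //; first by rewrite t0.
move=> s /andP[s0 st]; rewrite leNgt; apply/negP => rs.
have ts : t <= s.
  by apply: tmin; rewrite inE; split; rewrite /= ?in_itv/= ?s0 ?(le_trans st)// ltW.
by move: rs; rewrite (_ : s = t) ?fu ?ltxx//; apply/le_anti; rewrite st.
Qed.

End RealLine.

(** * The fundamental theorem of calculus for Lipschitz functions *)

Section LipschitzFTC.
Context {R : realType}.
Local Notation mu := (@lebesgue_measure R).
Implicit Types (f g h : R -> R) (a b x y : R).

(** Nondecreasing and 1-Lipschitz. In this form the class is stable under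
    [g |-> id - g], which is what bounds Stieltjes measures by Lebesgue
    measure below. *)
Definition slope01 g := forall x y, x <= y -> 0 <= g y - g x <= y - x.

Lemma slope01_nd g : slope01 g -> {homo g : x y / x <= y}.
Proof. by move=> g01 x y /g01/andP[]; rewrite subr_ge0. Qed.

Lemma slope01_dist g x y : slope01 g -> `|g x - g y| <= `|x - y|.
Proof.
move=> g01; wlog xy : x y / x <= y.
  move=> wl; have [|/ltW] := leP x y; first exact: wl.
  by move=> /wl; rewrite distrC (distrC y).
have /andP[? ?] := g01 _ _ xy.
by rewrite distrC (distrC x) ger0_norm// ger0_norm ?subr_ge0.
Qed.

Lemma slope01_rc g : slope01 g -> forall x, g @ at_right x --> g x.
Proof.
move=> g01; apply: right_continuousW => x; apply/cvgrPdist_lt => e e0.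
near=> y; apply: (le_lt_trans (slope01_dist _ _ g01)).
by near: y; exact: cvgr_dist_lt.
Unshelve. all: by end_near. Qed.

Lemma stieltjes_itvoc (G : cumulative R R) a b : a <= b ->
  lebesgue_stieltjes_measure G `]a, b]%classic = (G b - G a)%:E.
Proof.
move=> ab; rewrite /lebesgue_stieltjes_measure /measure_extension.
rewrite measurable_mu_extE; last exact: is_ocitv.
exact: wlength_itv_bnd.
Qed.

(** The Stieltjes measures of [g] and of [id - g] add up to Lebesgue measure,
    because they do so on half-open intervals. *)
Lemma slope01_dominated g (g01 : slope01 g) :
  let G : cumulative R R :=
    HB.pack g (isCumulative.Build R _ R g (slope01_nd g01) (slope01_rc g01)) in
  forall A, measurable A -> (lebesgue_stieltjes_measure G A <= mu A)%E.
Proof.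
move=> G A mA.
pose g' x := x - g x.
have g'01 : slope01 g' by move=> x y /g01/andP[? ?]; rewrite /g'; apply/andP; split; lra.
pose G' : cumulative R R :=
  HB.pack g' (isCumulative.Build R _ R g' (slope01_nd g'01) (slope01_rc g'01)).
pose nu := measure_add (lebesgue_stieltjes_measure G) (lebesgue_stieltjes_measure G').
have -> : mu A = nu A.
  apply: lebesgue_measure_unique => // _ [[u v] _ <-] /=.
  rewrite [RHS]measure_addE /lebesgue_measure.
  have [uv|vu] := leP u v.
    apply: (etrans (stieltjes_itvoc idfun uv)); apply/esym.
    have H : (lebesgue_stieltjes_measure G `]u, v]%classic +
      lebesgue_stieltjes_measure G' `]u, v]%classic = (v - u)%:E)%E.
      rewrite (stieltjes_itvoc G uv) (stieltjes_itvoc G' uv) -EFinD /=.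
      by congr EFin; rewrite /g'; ring.
    exact: H.
  rewrite set_itv_ge; first by rewrite !measure0 adde0.
  by rewrite -leNgt bnd_simp ltW.
by rewrite /nu measure_addE leeDl.
Qed.

(** The Radon-Nikodym theorem applied to the Stieltjes measure of [g],
    restricted to [[a, b]] so as to be finite. *)
Lemma slope01_density g a b : slope01 g ->
  exists h : R -> R, mu.-integrable setT (EFin \o h) /\
    forall x, a <= x <= b -> \int[mu]_(t in `[a, x]) h t = g x - g a.
Proof.
move=> g01.
pose G : cumulative R R :=
    HB.pack g (isCumulative.Build R _ R g (slope01_nd g01) (slope01_rc g01)).
have Gmu : forall A, measurable A -> (lebesgue_stieltjes_measure G A <= mu A)%E.
  exact: slope01_dominated.
have mab : measurable (`[a, b]%classic : set (measurableTypeR R)) by exact: measurable_itv.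
have Gfin : (lebesgue_stieltjes_measure G `[a, b]%classic < +oo)%E.
  apply: le_lt_trans (Gmu _ mab) _; rewrite lebesgue_measure_itv/=.
  by case: ifP => _; rewrite ?ltry// -EFinB ltry.
have [|h [h0 hfin hint hE]] :=
    @radon_nikodym_sigma_finite _ _ _ mu (mfrestr mab Gfin).
  apply/null_content_dominatesP => A mA A0.
  apply/eqP; rewrite eq_le measure_ge0 andbT -A0.
  apply: le_trans (Gmu _ mA); apply: le_measure; rewrite ?inE//.
  exact: measurableI.
have EFinfine : EFin \o (fine \o h) = h by apply/funext => x /=; rewrite fineK.
exists (fine \o h); split; first by rewrite EFinfine.
move=> x /andP[ax xb].
rewrite /Rintegral -[RHS]/(fine (g x - g a)%:E); congr fine.
rewrite -(stieltjes_itvoc G ax) -integral_itv_obnd_cbnd.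
  under eq_integral do rewrite -[_%:E]/((EFin \o (fine \o h)) _) EFinfine.
  rewrite -hE; last exact: measurable_itv.
  have sub : `]a, x]%classic `<=` `[a, b]%classic.
    by move=> y /=; rewrite !in_itv/= => /andP[/ltW-> /le_trans]; exact.
  exact: (congr1 (lebesgue_stieltjes_measure G) (setIidl sub)).
rewrite -[X in measurable_fun _ X]/(EFin \o (fine \o h)) EFinfine.
exact: (measurable_funS measurableT (@subsetT _ _) (measurable_int _ hint)).
Qed.

Lemma slope01_clamp a b : slope01 (clamp a b).
Proof.
move=> x y xy; rewrite /clamp.
case: (leP b x) => bx; case: (leP b y) => by_; try (by exfalso; lra).
- by rewrite subrr lexx subr_ge0.
- by case: (leP a b); case: (leP a x) => *; apply/andP; split; lra.
- by case: (leP a x); case: (leP a y) => *; apply/andP; split; lra.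
Qed.

(** After an affine change [f] has slopes between 0 and 1, hence a density by
    [slope01_density], which is its derivative at every Lebesgue point. *)
Lemma lipschitz_ftc f k a b :
  (forall x y, a <= x <= b -> a <= y <= b -> `|f x - f y| <= k * `|x - y|) ->
  a <= b ->
  exists h, [/\ mu.-integrable `[a, b] (EFin \o h),
    {ae mu, forall t, a < t < b -> is_derive t 1 f (h t)} &
    \int[mu]_(t in `[a, b]) h t = f b - f a].
Proof.
move=> fk ab.
(* [f / K] is 1-Lipschitz, so its mean with the identity has slopes between
   0 and 1; the added 1 keeps [K] positive. *)
pose K := `|k| + 1.
have K0 : 0 < K by rewrite ltr_wpDl.
pose c := clamp a b.
pose g t := (t + f (c t) / K) / 2.
have g01 : slope01 g.
  move=> x y xy.
  have cxy := slope01_clamp a b xy.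
  have : `|f (c y) / K - f (c x) / K| <= c y - c x.
    rewrite -mulrBl normrM normfV (gtr0_norm K0) ler_pdivrMr// mulrC.
    apply: le_trans (fk _ _ (clamp_itv _ ab) (clamp_itv _ ab)) _.
    rewrite ger0_norm; last by case/andP: cxy.
    apply: ler_wpM2r; first by case/andP: cxy.
    by rewrite /K (le_trans (ler_norm _))// lerDl.
  move: cxy; rewrite ler_norml -/c /g.
  move: (c x) (c y) (f _ / K) (f _ / K) => cx cy fx fy /andP[? ?] /andP[? ?].
  by apply/andP; split; lra.
have [h [hint hg]] := slope01_density a b g01.
have hint' : mu.-integrable `[a, b] (EFin \o h).
  by apply: integrableS hint => //; exact: measurable_itv.
have fE t : a <= t <= b -> f t = K * (2 * g t - t).
  move=> tab; rewrite /g /c clamp_id//; field; exact: lt0r_neq0.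
have mab : measurable (`[a, b]%classic : set (measurableTypeR R)) by exact: measurable_itv.
have cstint : mu.-integrable `[a, b] (EFin \o cst K).
  apply: continuous_compact_integrable; first exact: segment_compact.
  by apply: continuous_subspaceT => x; exact: cst_continuous.
exists (fun t => K * (2 * h t - 1)); split.
- have -> : EFin \o (fun t => K * (2 * h t - 1)) =
      ((fun t => (K * 2)%:E * (EFin \o h) t) \- (EFin \o cst K))%E.
    by apply/funext => t /=; rewrite -EFinM -EFinB; congr EFin; ring.
  have := integrableZl mab (K * 2) hint'.
  by move=> /(integrableB mab); apply; exact: cstint.
- have locint : locally_integrable setT h.
    by apply: open_integrable_locally => //; exact: openT.
  have := lebesgue_differentiation locint.
  apply: filterS; first exact: (ae_filter_ringOfSetsType mu).
  move=> t ht /andP[at_ tb].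
  have aBt : (BLeft a < BRight t)%E by rewrite lte_fin.
  have [Fd F't] := FTC1_lebesgue_pt tb hint' aBt ht.
  set F := fun y => _ in Fd F't.
  have Fis : is_derive t 1 F (h t).
    by apply: DeriveDef => //; rewrite -F't derive1E.
  apply: (@near_eq_is_derive _ _ _ (fun s => K * (2 * (F s + g a) - s))).
    near=> s.
    have sab : a <= s <= b.
      by apply/andP; split; apply/ltW; near: s; [exact: lt_nbhsr|exact: lt_nbhsl].
    by rewrite fE// /F hg// subrK.
  apply: is_derive_eq.
  rewrite /GRing.scale/=; ring.
- under eq_Rintegral do rewrite mulrBr mulr1 mulrA.
  rewrite RintegralB//; last exact: (integrableZl mab (K * 2) hint').
  rewrite RintegralZl//.
  have muab : mu `[a, b] = (b - a)%:E.
    rewrite lebesgue_measure_itv/= lte_fin.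
    have [ab'|ba] := ltP a b; first by rewrite -EFinB.
    by have -> : a = b by [apply/le_anti/andP]; rewrite subrr.
  rewrite Rintegral_cst// [fine _](congr1 fine muab)/=.
  by rewrite hg ?lexx ?ab// !fE ?lexx ?ab//; ring.
Unshelve. all: by end_near. Qed.

End LipschitzFTC.

(** * Measurability of the derivative of a continuous curve *)

Section DerivativeMeasurable.
Context {R : realType}.
Implicit Types f : R -> R.

Definition quotient f (h t : R) : R := h^-1 * (f (h + t) - f t).

Lemma quotient_continuous f h : continuous f -> continuous (quotient f h).
Proof.
move=> cf t; apply: cvgMr; apply: cvgB; last exact: cf.
apply: continuous_comp; last exact: cf.
by apply: cvgD; [exact: cvg_cst|exact: cvg_id].
Qed.

(** The Cauchy criterion for the difference quotients, at precision [e] and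
    for increments smaller than [r]. *)
Definition quotients_close f (e r : R) : set R := [set t |
  forall h h', 0 < `|h| < r -> 0 < `|h'| < r ->
    `|quotient f h t - quotient f h' t| <= e].

Lemma quotients_close_closed f e r : continuous f -> closed (quotients_close f e r).
Proof.
move=> cf.
pose P := [set z : R * R | 0 < `|z.1| < r /\ 0 < `|z.2| < r].
pose C z := [set t | `|quotient f z.1 t - quotient f z.2 t| <= e].
have -> : quotients_close f e r = \bigcap_(z in P) C z.
  apply/seteqP; split=> t.
    by move=> qt [h h'] [/= ? ?]; exact: qt.
  by move=> qt h h' ? ?; exact: (qt (h, h')).
apply: closed_bigI => z _.
apply: (@closed_comp _ _ (fun t => `|quotient f z.1 t - quotient f z.2 t|)
  [set x | x <= e]); last exact: closed_le.
move=> t _; apply: cvg_norm; apply: cvgB; exact: quotient_continuous.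
Qed.

Lemma derivable_quotient f t :
  derivable f t 1 = cvg (quotient f h t @[h --> 0^']).
Proof.
rewrite /derivable; set d := (fun h => _ *: _).
suff -> : d = quotient f ^~ t by [].
by apply/funext => h; rewrite /d /quotient /= [h%:A]mulr1.
Qed.

(** By completeness differentiability is a Cauchy criterion. Only countably
    many precisions and scales matter, and the uncountable quantifier over
    the increments stays inside a closed set. *)
Lemma derivable_setE f : [set t | derivable f t 1] =
  \bigcap_k \bigcup_n quotients_close f k.+1%:R^-1 n.+1%:R^-1.
Proof.
apply/seteqP; split=> t /=; rewrite derivable_quotient.
  move=> /cvg_ex[/= l fl] k _.
  have k0 : 0 < (k.+1%:R^-1 : R) / 2 by rewrite divr_gt0.
  move/cvgrPdist_le : fl => /(_ _ k0)[d /= d0 dl].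
  have [n nd] := exists_invS_lt d0.
  exists n => // h h' /andP[h0 hn] /andP[h'0 h'n].
  have q (s : R) : 0 < `|s| -> `|s| < n.+1%:R^-1 ->
      `|l - quotient f s t| <= k.+1%:R^-1 / 2.
    move=> s0 sn; apply: dl; last by rewrite -normr_gt0.
    by rewrite /ball_/= sub0r normrN (lt_trans sn).
  rewrite -(subrKA l) (le_trans (ler_normD _ _))// [leRHS]splitr lerD ?q//.
  by rewrite distrC q.
move=> qt; apply: cauchy_cvg; apply: cauchy_exP => e e0.
have [k ke] := exists_invS_lt e0.
have [n _ qn] := qt k I.
have n0 : 0 < (n.+1%:R^-1 : R) by rewrite invr_gt0.
exists (quotient f (n.+1%:R^-1 / 2) t) => /=.
near=> h; rewrite /ball /= /ball_; apply: le_lt_trans ke; apply: qn.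
  by rewrite gtr0_norm ?divr_gt0//= gtr_pMr// invf_lt1// ltr1n.
apply/andP; split.
  by rewrite normr_gt0; near: h; exact: nbhs_dnbhs_neq.
by near: h; exact: dnbhs0_lt.
Unshelve. all: by end_near. Qed.

Lemma derive1_measurable f : continuous f ->
  measurable [set t | derivable f t 1] /\
  measurable_fun [set t | derivable f t 1] (derive1 f).
Proof.
move=> cf; split.
  rewrite derivable_setE; apply: bigcap_measurable => // k _.
  apply: bigcup_measurable => n _; apply: closed_measurable.
  exact: quotients_close_closed.
apply: (@measurable_fun_cvg _ _ _ _ (fun n => quotient f n.+1%:R^-1)).
  move=> n; apply: measurable_funTS; apply: continuous_measurable_fun.
  exact: quotient_continuous.
move=> t /=; rewrite derivable_quotient => ft.
rewrite derive1E /derive.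
have <- : quotient f ^~ t = (fun h => h^-1 *: ((f \o shift t) (h *: 1) - f t)).
  by apply/funext => h; rewrite /quotient /= [h%:A]mulr1.
apply: (cvg_comp (fun n => n.+1%:R^-1) (quotient f ^~ t) _ ft).
move=> A [e /= e0 eA]; have [N Ne] := exists_invS_lt e0.
exists N => // n /= Nn; apply: eA => /=.
  rewrite /ball_/= sub0r normrN gtr0_norm ?invr_gt0//.
  by apply: le_lt_trans Ne; rewrite lef_pV2 ?posrE// ler_nat ltnS.
by rewrite invr_neq0// pnatr_eq0.
Qed.
End DerivativeMeasurable.
Section SpeedMeasurable.
Context {R : realType} {N : nat}.
Implicit Types (g : R -> 'rV[R]_N).

Lemma coord_of_continuous g i : continuous g -> continuous (fun t => g t ord0 i).
Proof.
move=> cg t.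
apply: (@cvg_comp _ _ _ g (fun v : 'rV[R]_N => v ord0 i) _ _ _ (cg t)).
exact: (@coord_continuous R 1 N ord0 i (g t)).
Qed.

Lemma derive1_coord g t i : derivable g t 1 ->
  (derive1 g t) ord0 i = derive1 (fun s => g s ord0 i) t.
Proof. by move=> gt; rewrite !derive1E derive_mx// mxE. Qed.

(** The value of a missing limit is the default one, which is [0]. *)
Lemma derive1_not_derivable g t : ~ derivable g t 1 -> derive1 g t = 0.
Proof.
move=> gt; rewrite derive1E /derive dvgP//.
by apply/matrixP => i j; rewrite !mxE.
Qed.

Lemma derivable_rowP g t :
  derivable g t 1 <-> forall i, derivable (fun s => g s ord0 i) t 1.
Proof.
rewrite derivable_mxP; split=> [gt i|gt i j]; first exact: gt.
by rewrite (ord1 i); exact: gt.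
Qed.

(** On the Borel set where the curve is differentiable its derivative is a
    limit of continuous difference quotients; elsewhere it is [0]. *)
Lemma speed_measurable g : continuous g ->
  measurable_fun setT (fun t => enorm (derive1 g t)).
Proof.
move=> cg.
pose D := [set t | derivable g t 1].
have DE : D = \bigcap_(i in [set: 'I_N]) [set t | derivable (fun s => g s ord0 i) t 1].
  by apply/seteqP; split=> t; rewrite /D/= derivable_rowP => gt i; [move=> _|]; exact: gt.
have mD : measurable D.
  rewrite DE; apply: fin_bigcap_measurable => // i _.
  by apply: (derive1_measurable _).1; exact: coord_of_continuous.
rewrite -(setUv D); apply/measurable_funU => //; first exact: measurableC.
split.
  apply: (eq_measurable_fun (fun t =>
      Num.sqrt (\sum_(i < N) (derive1 (fun s => g s ord0 i) t) ^+ 2))).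
    move=> t /[!inE] Dt; rewrite /enorm; congr Num.sqrt.
    by apply: eq_bigr => i _; rewrite derive1_coord.
  have msq : measurable_fun setT (@Num.sqrt R).
    by apply: continuous_measurable_fun => x; exact: sqrt_continuous.
  apply: (measurableT_comp msq).
  apply: measurable_sum => i; apply: measurable_funX.
  have [mDi] := derive1_measurable (coord_of_continuous (i := i) cg).
  by apply: measurable_funS => // t; rewrite /D/= derivable_rowP; exact.
apply: (eq_measurable_fun (fun=> 0 : R)); last exact: measurable_cst.
by move=> t /[!inE] Dt; rewrite derive1_not_derivable// enorm0.
Qed.

Definition integrand (W : 'rV[R]_N -> R) g t : R :=
  Num.sqrt (W (g t)) * enorm (derive1 g t).

Lemma integrand_ge0 W g t : 0 <= integrand W g t.
Proof. by rewrite mulr_ge0 ?sqrtr_ge0. Qed.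

Lemma integrand_measurable W g : continuous W -> continuous g ->
  measurable_fun setT (integrand W g).
Proof.
move=> cW cg; apply: measurable_funM; last exact: speed_measurable.
apply: continuous_measurable_fun => t.
apply: (@cvg_comp _ _ _ (W \o g) Num.sqrt _ (nbhs (W (g t)))); last exact: sqrt_continuous.
exact: (@cvg_comp _ _ _ g W _ _ _ (cg t) (cW (g t))).
Qed.

End SpeedMeasurable.

(** * Restriction of curves and the energy of their arcs *)

Section Curves.
Context {R : realType} {N : nat}.
Variable W : 'rV[R]_N -> R.
Hypothesis W_cont : continuous W.
Local Notation mu := (@lebesgue_measure R).
Implicit Types (g : R -> 'rV[R]_N) (a b c t : R).

(** The condition at a single time in [locally_elipschitz], so that gluing
    and localization can be stated time by time. *)
Definition lip_at (A : set R) g t := exists2 e : R, 0 < e & exists k : R,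
  forall s s', A s -> A s' -> `|s - t| < e -> `|s' - t| < e ->
    enorm (g s - g s') <= k * `|s - s'|.

Definition nonzero_times g : set R := [set` `[0, 1]] `\` zero_times W g.

Lemma nonzero_timesP g t : nonzero_times g t <-> 0 <= t <= 1 /\ W (g t) <> 0.
Proof.
rewrite /nonzero_times /zero_times /zero_set/= in_itv/=.
split=> [[t01 h]|[t01 h]]; split=> //; last by case.
by move=> Wt; apply: h.
Qed.

Lemma LipZP g : LipZ W g <-> {within `[0, 1], continuous g} /\
  forall t, nonzero_times g t -> lip_at (nonzero_times g) g t.
Proof. by []. Qed.

Lemma lip_at_comp A B g (p : R -> R) k t : 0 < k ->
  (forall s s', `|p s - p s'| <= k * `|s - s'|) ->
  (forall s, B s -> A (p s)) -> lip_at A g (p t) -> lip_at B (g \o p) t.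
Proof.
move=> k0 pk BA [e e0 [K gK]]; exists (e / k); first by rewrite divr_gt0.
exists (`|K| * k) => s s' Bs Bs' st s't /=.
have pe u : `|u - t| < e / k -> `|p u - p t| < e.
  by rewrite ltr_pdivlMr// mulrC; exact: le_lt_trans.
apply: le_trans (gK _ _ (BA _ Bs) (BA _ Bs') (pe _ st) (pe _ s't)) _.
apply: (@le_trans _ _ (`|K| * `|p s - p s'|)).
  by rewrite ler_wpM2r// ler_norm.
by rewrite -mulrA ler_wpM2l.
Qed.

Lemma within_continuous_comp g (p : R -> R) (A : set R) :
  {within A, continuous g} -> (forall s, A (p s)) -> continuous p ->
  continuous (g \o p).
Proof.
move=> /subspace_continuousP cg Ap cp t.
apply: (@cvg_comp _ _ _ p g _ (within A (nbhs (p t)))); last exact: cg.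
move=> B /= [e /= e0 eB]; have /cvgrPdist_lt/(_ e e0) := cp t.
apply: filterS => s /= st; exact: eB.
Qed.

Lemma LipZ_comp g (p : R -> R) k : 0 < k ->
  (forall s s', `|p s - p s'| <= k * `|s - s'|) ->
  (forall s, 0 <= s <= 1 -> 0 <= p s <= 1) -> LipZ W g -> LipZ W (g \o p).
Proof.
move=> k0 pk p01 /LipZP[cg lg]; apply/LipZP; split.
  move/subspace_continuousP: cg => cg; apply/subspace_continuousP => t t01.
  have pt01 : p t \in `[0, 1] by move: t01; rewrite /= !in_itv/=; exact: p01.
  apply: (@cvg_comp _ _ _ p g _ (within `[0, 1]%classic (nbhs (p t)))); last exact: cg.
  move=> B /= [e /= e0 eB].
  have cp := lipschitz_continuous pk.
  have /cvgrPdist_lt/(_ e e0) := cp t.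
  apply: filterS => s /= st s01; apply: eB => //.
  by move: s01; rewrite /= !in_itv/=; exact: p01.
move=> t /nonzero_timesP[t01 Wt].
apply: (lip_at_comp k0 pk (A := nonzero_times g)).
  by move=> s /nonzero_timesP[s01 Ws]; apply/nonzero_timesP; split=> //; exact: p01.
by apply: lg; apply/nonzero_timesP; split=> //; exact: p01.
Qed.

Lemma clamp_dist a b s s' : `|clamp a b s - clamp a b s'| <= 1 * `|s - s'|.
Proof. by rewrite mul1r; exact: slope01_dist (slope01_clamp a b). Qed.

Lemma LipZ_clamp g a b : 0 <= a -> a <= b -> b <= 1 ->
  LipZ W g -> LipZ W (g \o clamp a b).
Proof.
move=> a0 ab b1; apply: LipZ_comp (clamp_dist a b) _ => // s _.
by have /andP[? ?] := clamp_itv s ab; apply/andP; split; lra.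
Qed.

Lemma LipZ_clamp_continuous g a b : 0 <= a -> a <= b -> b <= 1 ->
  LipZ W g -> continuous (g \o clamp a b).
Proof.
move=> a0 ab b1 [cg _]; apply: within_continuous_comp cg _ _.
  move=> s; have /andP[? ?] := clamp_itv s ab.
  by rewrite /= in_itv/=; apply/andP; split; lra.
exact: lipschitz_continuous (clamp_dist a b).
Qed.

Lemma integrand_near g g' t : (\near t, g t = g' t) ->
  integrand W g t = integrand W g' t.
Proof.
move=> gg'; rewrite /integrand !derive1E (near_eq_derive _ gg').
by rewrite (nbhs_singleton gg').
Qed.

Lemma integrand_cst v t : integrand W (fun=> v) t = 0.
Proof. by rewrite /integrand derive1_cst enorm0 mulr0. Qed.

Lemma integrand_clamp_in g a b t : a < t < b ->
  integrand W (g \o clamp a b) t = integrand W g t.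
Proof.
move=> atb; apply: integrand_near; near=> s.
have /andP[? ?] : a < s < b by near: s; exact: near_itv.
by rewrite /= clamp_id// !ltW.
Unshelve. all: by end_near. Qed.

Lemma integrand_clamp_out g a b t : a <= b -> t < a \/ b < t ->
  integrand W (g \o clamp a b) t = 0.
Proof.
move=> ab [ta|bt].
  rewrite -(integrand_cst (g a) t); apply: integrand_near; near=> s.
  by rewrite /= clamp_left// ltW//; near: s; exact: lt_nbhsl.
rewrite -(integrand_cst (g b) t); apply: integrand_near; near=> s.
by rewrite /= clamp_right// ltW//; near: s; exact: lt_nbhsr.
Unshelve. all: by end_near. Qed.

Lemma LipZ_integrand_measurable g a b : LipZ W g -> 0 <= a -> b <= 1 ->
  measurable_fun `]a, b[ (integrand W g).
Proof.
move=> Zg a0 b1; apply: (eq_measurable_fun (integrand W (g \o clamp 0 1))).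
  move=> t; rewrite inE/= in_itv/= => /andP[? ?].
  by apply: integrand_clamp_in; apply/andP; split; lra.
apply: measurable_funTS; apply: integrand_measurable => //.
exact: LipZ_clamp_continuous.
Qed.

Lemma LipZ_eintegrand_measurable g a b : LipZ W g -> 0 <= a -> b <= 1 ->
  measurable_fun (`]a, b[%classic : set (measurableTypeR R))
    (fun t => (integrand W g t)%:E).
Proof.
by move=> Zg a0 b1; apply/measurable_EFinP; exact: LipZ_integrand_measurable.
Qed.

(** The interval is open because the derivatives at [a] and [b] may depend on
    what the curve does outside [[a, b]]. *)
Definition arc g a b : \bar R := (\int[mu]_(t in `]a, b[) (integrand W g t)%:E)%E.

Lemma arc_ge0 g a b : (0 <= arc g a b)%E.
Proof. by apply: integral_ge0 => t _; rewrite lee_fin integrand_ge0. Qed.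

Lemma LipZ_energy g : LipZ W g -> energy W g = arc g 0 1.
Proof.
move=> Zg; apply: (integral_itv_bndoo true false).
exact: (LipZ_eintegrand_measurable Zg (lexx 0) (lexx 1)).
Qed.

Lemma arcD g a b c : LipZ W g -> 0 <= a -> a <= b -> b <= c -> c <= 1 ->
  arc g a c = (arc g a b + arc g b c)%E.
Proof.
move=> Zg a0 ab bc c1.
move: ab; rewrite le_eqVlt => /orP[/eqP<-|ab].
  by rewrite {2}/arc set_itvoo0 integral_set0 add0e.
move: bc; rewrite le_eqVlt => /orP[/eqP<-|bc].
  by rewrite {3}/arc set_itvoo0 integral_set0 adde0.
have mg u v : 0 <= u -> v <= 1 ->
    measurable_fun (`]u, v[%classic : set (measurableTypeR R))
    (fun t => (integrand W g t)%:E) := LipZ_eintegrand_measurable Zg.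
have ac : `]a, c[%classic = `]a, b]%classic `|` `]b, c[%classic :> set (measurableTypeR R).
  by rewrite -itv_bndbnd_setU ?bnd_simp// ltW.
have b1 : b <= 1 by rewrite (le_trans (ltW bc)).
have b0 : 0 <= b by rewrite (le_trans a0)// ltW.
rewrite [LHS]/arc ac ge0_integral_setU.
- by congr (_ + _)%E; apply: (integral_itv_bndoo false false); exact: mg.
- exact: measurable_itv.
- exact: measurable_itv.
- by rewrite -ac; exact: mg.
- by move=> t _; rewrite lee_fin integrand_ge0.
- apply: lt_disjoint => x y; rewrite !in_itv/= => /andP[_ xb] /andP[b_y _].
  exact: le_lt_trans xb b_y.
Qed.

End Curves.

Section CurveEnergies.
Context {R : realType} {N : nat}.
Variable W : 'rV[R]_N -> R.
Hypothesis W_cont : continuous W.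
Local Notation mu := (@lebesgue_measure R).
Implicit Types (g : R -> 'rV[R]_N) (a b c t : R).

Lemma eq_arc g h a b : (forall t, a < t < b -> integrand W g t = integrand W h t) ->
  arc W g a b = arc W h a b.
Proof.
by move=> gh; apply: eq_integral => t; rewrite inE/= in_itv/= => /gh ->.
Qed.

Lemma arc_eq0 g a b : (forall t, a < t < b -> integrand W g t = 0) ->
  arc W g a b = 0%E.
Proof.
by move=> g0; apply: integral0_eq => t; rewrite /= in_itv/= => /g0 ->.
Qed.

Lemma energy_clamp g a b : LipZ W g -> 0 <= a -> a <= b -> b <= 1 ->
  energy W (g \o clamp a b) = arc W g a b.
Proof.
move=> Zg a0 ab b1; have Zc := LipZ_clamp a0 ab b1 Zg.
have b0 : 0 <= b by rewrite (le_trans a0).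
rewrite (LipZ_energy W_cont Zc).
rewrite (arcD W_cont Zc (lexx 0) a0 (le_trans ab b1) (lexx 1)).
rewrite (arcD W_cont Zc a0 ab b1 (lexx 1)).
have -> : arc W (g \o clamp a b) 0 a = 0%E.
  by apply: arc_eq0 => t /andP[_ ?]; apply: integrand_clamp_out => //; left.
have -> : arc W (g \o clamp a b) b 1 = 0%E.
  by apply: arc_eq0 => t /andP[? _]; apply: integrand_clamp_out => //; right.
rewrite add0e adde0.
by apply: eq_arc => t; exact: integrand_clamp_in.
Qed.

Lemma wdist_le_energy g x y : LipZ W g -> g 0 = x -> g 1 = y ->
  (wdist W x y <= energy W g)%E.
Proof. by move=> Zg gx gy; apply: ereal_inf_lbound; exists g. Qed.

Lemma wdist_ge0 x y : (0 <= wdist W x y)%E.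
Proof.
apply: le_ereal_inf_tmp => _ [g _ <-]; apply: integral_ge0 => t _.
by rewrite lee_fin (integrand_ge0 W g).
Qed.

(** The curve frozen outside [[a, b]] is a competitor for the distance
    between [g a] and [g b]. *)
Lemma wdist_le_arc g a b : LipZ W g -> 0 <= a -> a <= b -> b <= 1 ->
  (wdist W (g a) (g b) <= arc W g a b)%E.
Proof.
move=> Zg a0 ab b1; rewrite -energy_clamp//; apply: wdist_le_energy.
- exact: LipZ_clamp.
- by rewrite /= clamp_left.
- by rewrite /= clamp_right.
Qed.

Lemma partition_sum_le_arc g s a : LipZ W g -> 0 <= a -> path <%R a s ->
  last a s = 1 ->
  (\sum_(0 <= j < size s)
     wdist W (g (nth 1%R (a :: s) j)) (g (nth 1%R (a :: s) j.+1)) <= arc W g a 1)%E.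
Proof.
move=> Zg; elim: s a => [|b s IH] a a0 /=.
  by rewrite big_nil arc_ge0.
move=> /andP[ab bs] s1; rewrite big_nat_recl//=.
have b0 : 0 <= b by rewrite (le_trans a0)// ltW.
have b1 : b <= 1.
  rewrite -s1; case: (s) bs => [//|c s']; rewrite lt_path_sortedE => /andP[/allP bs _].
  by apply/ltW/bs => /=; exact: mem_last.
rewrite (arcD W_cont Zg a0 (ltW ab) b1)//; apply: leeD.
  by apply: wdist_le_arc => //; exact: ltW.
exact: IH.
Qed.

Lemma curve_length_le_energy g : LipZ W g -> (curve_length W g <= energy W g)%E.
Proof.
move=> Zg; apply: ge_ereal_sup => _ [s [s01 /eqP s1] <-].
by rewrite LipZ_energy//; exact: partition_sum_le_arc.
Qed.

Lemma wdist_le_curve_length g x y : LipZ_from_to W x y g ->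
  (wdist W x y <= curve_length W g)%E.
Proof.
move=> [_ <- <-]; apply: ereal_sup_ubound; exists [:: 1].
  by rewrite /itv_partition/= ltr01 eqxx.
by rewrite /partition_sum big_nat1.
Qed.
End CurveEnergies.

(** * Affine reparametrization *)

Section Affine.
Context {R : realType}.
Local Notation mu := (@lebesgue_measure R).
Implicit Types (k r : R) (f : R -> \bar R).

Definition affine k r t : R := k * t + r.

Lemma affine_measurable k r :
  measurable_fun setT (affine k r : measurableTypeR R -> measurableTypeR R).
Proof.
apply: measurable_funD; last exact: measurable_cst.
exact: mulrl_measurable.
Qed.

Lemma affineK k r : k != 0 -> cancel (affine k r) (affine k^-1 (- (k^-1 * r))).
Proof. by move=> k0 t; rewrite /affine mulrDr mulKf// addrK. Qed.

Lemma affine_preimage_ocitv k r (a b : R) : k != 0 ->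
  mu (affine k r @^-1` `]a, b]) = ((`|k|^-1)%:E * mu `]a, b]%classic)%E.
Proof.
move=> k0; rewrite lebesgue_measure_itv/= lte_fin.
have [kp|kn|/eqP] := ltgtP k 0; last by rewrite (negbTE k0).
  have -> : affine k r @^-1` `]a, b] = `[(b - r) / k, (a - r) / k[%classic.
    apply/seteqP; split=> t /=; rewrite !in_itv/= /affine ler_ndivrMr// ltr_ndivlMr//;
      by rewrite mulrC; move=> /andP[? ?]; apply/andP; split; lra.
  rewrite lebesgue_measure_itv/= lte_fin ltr_nM2r ?invr_lt0// ltrD2r.
  case: ifPn => _; last by rewrite mule0.
  by rewrite -EFinB -EFinB -EFinM ltr0_norm// ; congr EFin; field.
have -> : affine k r @^-1` `]a, b] = `](a - r) / k, (b - r) / k]%classic.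
  apply/seteqP; split=> t /=; rewrite !in_itv/= /affine ler_pdivlMr// ltr_pdivrMr//;
    by rewrite mulrC; move=> /andP[? ?]; apply/andP; split; lra.
rewrite lebesgue_measure_itv/= lte_fin ltr_pM2r ?invr_gt0// ltrD2r.
case: ifPn => _; last by rewrite mule0.
by rewrite -EFinB -EFinB -EFinM gtr0_norm// ; congr EFin; field.
Qed.

(** The image of Lebesgue measure under [affine k r], multiplied by [`|k|],
    is Lebesgue measure: the two agree on half-open intervals. *)
Lemma ge0_integral_affine k r f (D : set (measurableTypeR R)) : k != 0 ->
  measurable D -> measurable_fun D f -> (forall t, D t -> (0 <= f t)%E) ->
  (\int[mu]_(t in D) f t =
   `|k|%:E * \int[mu]_(t in (affine k r @^-1` D : set (measurableTypeR R)))
     f (affine k r t))%E.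
Proof.
move=> k0 mD mf f0.
have nk : (0 <= `|k|)%R by [].
have f0' : {in D, forall y, (0 <= f y)%E} by move=> t /[!inE]; exact: f0.
rewrite -(ge0_integral_pushforward (affine_measurable k r) mu mD mf f0').
rewrite -(ge0_integral_mscale _ mD (NngNum nk) mf f0).
  exact: affine_measurable.
move=> mkr; apply: eq_measure_integral => A mA _.
apply: lebesgue_measure_unique => // _ [[a b] _ <-].
rewrite /= /mscale/= /pushforward affine_preimage_ocitv// muleA -EFinM.
by rewrite mulfV ?normr_eq0// mul1e.
Qed.
End Affine.
Section AffineReparametrization.
Context {R : realType} {N : nat}.
Variable W : 'rV[R]_N -> R.
Hypothesis W_cont : continuous W.
Local Notation mu := (@lebesgue_measure R).
Implicit Types (g : R -> 'rV[R]_N) (a b c t k r : R).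

Lemma affine_is_derive k r t : is_derive t 1 (affine k r) k.
Proof.
rewrite /affine; apply: is_derive_eq.
by rewrite /GRing.scale/=; ring.
Qed.

Lemma is_derive_affine_comp g k r t v : is_derive (affine k r t) 1 g v ->
  is_derive t 1 (g \o affine k r) (k *: v).
Proof.
move=> [gv gE]; have [av aE] := affine_is_derive k r t.
have dg : differentiable g (affine k r t) by apply/derivable1_diffP.
have da : differentiable (affine k r) t by apply/derivable1_diffP.
have dc : differentiable (g \o affine k r) t by exact: differentiable_comp.
apply: DeriveDef; first exact/derivable1_diffP.
rewrite deriveE// diff_comp//= -(deriveE _ da) aE.
rewrite -[X in 'd g _ X]mulr1 -[X in 'd g _ X]/(k *: (1 : R)) linearZ/=.
by rewrite -(deriveE _ dg) gE.
Qed.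

(** This also holds where [g] is not differentiable: [affine k r] being
    invertible, the composition is not differentiable there either, and both
    derivatives have the default value [0]. *)
Lemma derive1_affine_comp g k r t : k != 0 ->
  derive1 (g \o affine k r) t = k *: derive1 g (affine k r t).
Proof.
move=> k0; have [gd|gnd] := pselect (derivable g (affine k r t) 1).
  have [_] := is_derive_affine_comp (DeriveDef gd erefl).
  by rewrite !derive1E.
have -> : derive1 g (affine k r t) = 0 by exact: derive1_not_derivable.
rewrite scaler0; apply: derive1_not_derivable => gcd; apply: gnd.
have gE : g = (g \o affine k r) \o affine k^-1 (- (k^-1 * r)).
  apply/funext => s /=; congr g.
  by rewrite /affine mulrDr mulrN !mulVKf// subrK.
have tE : affine k^-1 (- (k^-1 * r)) (affine k r t) = t by exact: affineK.
rewrite [X in derivable X]gE.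
have := @is_derive_affine_comp (g \o affine k r) k^-1 (- (k^-1 * r)) (affine k r t).
by rewrite tE => /(_ _ (DeriveDef gcd erefl))[].
Qed.

Lemma integrand_affine_comp g k r t : k != 0 ->
  integrand W (g \o affine k r) t = `|k| * integrand W g (affine k r t).
Proof. by move=> k0; rewrite /integrand derive1_affine_comp// enormZ /=; ring. Qed.

Lemma arc_affine g k r a b a' b' : k != 0 ->
  (forall t, (a < t < b) = (a' < affine k r t < b')) ->
  LipZ W g -> 0 <= a' -> b' <= 1 ->
  arc W (g \o affine k r) a b = arc W g a' b'.
Proof.
move=> k0 abE Zg a'0 b'1.
have mf := LipZ_eintegrand_measurable W_cont Zg a'0 b'1.
have preE : affine k r @^-1` `]a', b'[ = `]a, b[%classic.
  by apply/seteqP; split=> t /=; rewrite !in_itv/= abE.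
have mab : measurable (`]a, b[%classic : set (measurableTypeR R)).
  exact: measurable_itv.
have mab' : measurable (`]a', b'[%classic : set (measurableTypeR R)).
  exact: measurable_itv.
have mfa : measurable_fun (`]a, b[%classic : set (measurableTypeR R))
    (fun t => (integrand W g (affine k r t))%:E).
  apply: (measurable_comp mab' _ mf).
    by move=> _ [t tab <-]; move: tab; rewrite /= !in_itv/= abE.
  exact: measurable_funS (affine_measurable k r).
rewrite [RHS]/arc (ge0_integral_affine r k0 mab' mf); last first.
  by move=> t _; rewrite lee_fin integrand_ge0.
rewrite preE; transitivity
    (\int[mu]_(t in `]a, b[) (`|k|%:E * (integrand W g (affine k r t))%:E))%E.
  by apply: eq_integral => t _; rewrite -EFinM integrand_affine_comp.
apply: (ge0_integralZl mu mab mfa); last by rewrite lee_fin.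
by move=> t _; rewrite lee_fin integrand_ge0.
Qed.
End AffineReparametrization.

(** * Reversal and concatenation of curves *)

Section Triangle.
Context {R : realType} {N : nat}.
Variable W : 'rV[R]_N -> R.
Hypothesis W_cont : continuous W.
Implicit Types (g : R -> 'rV[R]_N) (x y z : 'rV[R]_N) (t k r : R).

Lemma affine_dist k r s t : `|affine k r s - affine k r t| <= `|k| * `|s - t|.
Proof.
rewrite -normrM /affine.
by have -> : k * s + r - (k * t + r) = k * (s - t) by ring.
Qed.

Lemma wdist_sym_le x y : (wdist W x y <= wdist W y x)%E.
Proof.
apply: le_ereal_inf_tmp => _ [g [Zg gy gx] <-].
have Zr : LipZ W (g \o affine (-1) 1).
  apply: LipZ_comp (affine_dist (-1) 1) _ Zg; first by rewrite normrN1.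
  by move=> s /andP[? ?]; rewrite /affine; apply/andP; split; lra.
have -> : energy W g = energy W (g \o affine (-1) 1).
  rewrite (LipZ_energy W_cont Zg) (LipZ_energy W_cont Zr).
  apply/esym; apply: (arc_affine W_cont _ _ Zg); rewrite ?lexx ?oppr_eq0 ?oner_eq0//.
  by move=> t; rewrite /affine; apply/idP/idP => /andP[? ?]; apply/andP; split; lra.
apply: wdist_le_energy => //=; rewrite /affine.
  by rewrite mulr0 add0r.
by rewrite mulr1 addNr.
Qed.

Lemma wdistC x y : wdist W x y = wdist W y x.
Proof. by apply/eqP; rewrite eq_le !wdist_sym_le. Qed.

(** If [t] is not [m], a small neighbourhood of [t] lies on one side of [m].
    If it is, two points on opposite sides are compared through [g t]. *)
Lemma lip_at_glue (A : set R) g m t : A t ->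
  (t <= m -> lip_at (A `&` [set s | s <= m]) g t) ->
  (m <= t -> lip_at (A `&` [set s | m <= s]) g t) -> lip_at A g t.
Proof.
move=> At gl gr; have [tm|mt|tm] := ltgtP t m.
- have [e e0 [k gk]] := gl (ltW tm).
  exists (Num.min e (m - t)); first by rewrite lt_min e0 subr_gt0.
  exists k => s s' As As'; rewrite !lt_min => /andP[se sm] /andP[s'e s'm].
  apply: gk => //; split=> //=.
    by move: sm; rewrite ltr_norml; lra.
  by move: s'm; rewrite ltr_norml; lra.
- have [e e0 [k gk]] := gr (ltW mt).
  exists (Num.min e (t - m)); first by rewrite lt_min e0 subr_gt0.
  exists k => s s' As As'; rewrite !lt_min => /andP[se sm] /andP[s'e s'm].
  apply: gk => //; split=> //=.
    by move: sm; rewrite ltr_norml; lra.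
  by move: s'm; rewrite ltr_norml; lra.
- have tm1 : t <= m by rewrite tm.
  have tm2 : m <= t by rewrite tm.
  have [e e0 [k gk]] := gl tm1.
  have [e' e'0 [k' gk']] := gr tm2.
  exists (Num.min e e'); first by rewrite lt_min e0.
  exists (`|k| + `|k'|).
  have tt (c : R) : 0 < c -> `|t - t| < c by rewrite subrr normr0.
  have K1 (s s' : R) : k * `|s - s'| <= (`|k| + `|k'|) * `|s - s'|.
    by rewrite ler_wpM2r// (le_trans (ler_norm _))// lerDl.
  have K2 (s s' : R) : k' * `|s - s'| <= (`|k| + `|k'|) * `|s - s'|.
    by rewrite ler_wpM2r// (le_trans (ler_norm _))// lerDr.
  have across s s' : A s -> A s' -> `|s - t| < Num.min e e' ->
      `|s' - t| < Num.min e e' -> s <= m -> m <= s' ->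
      enorm (g s - g s') <= (`|k| + `|k'|) * `|s - s'|.
    move=> As As'; rewrite !lt_min => /andP[se _] /andP[_ s'e] sm ms'.
    apply: le_trans (enorm_distD (g t) _ _) _.
    have -> : `|s - s'| = `|s - t| + `|t - s'|.
      by rewrite !ler0_norm ?subr_le0 ?tm// ?(le_trans sm ms')//; lra.
    rewrite mulrDr; apply: lerD.
      by apply: (le_trans _ (K1 s t)); apply: gk => //; first [by split|exact: tt].
    by apply: (le_trans _ (K2 t s')); apply: gk' => //; first [by split|exact: tt].
  move=> s s' As As' se s'e.
  have [sm|ms] := leP s m; have [s'm|ms'] := leP s' m.
  + move: se s'e; rewrite !lt_min => /andP[? _] /andP[? _].
    by apply: (le_trans _ (K1 s s')); apply: gk.
  + exact: across (ltW ms').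
  + by rewrite enormBC distrC; apply: across => //; exact: ltW.
  + move: se s'e; rewrite !lt_min => /andP[_ ?] /andP[_ ?].
    by apply: (le_trans _ (K2 s s')); apply: gk' => //; split=> //=; exact: ltW.
Qed.

Lemma lip_at_eq (A : set R) g g' t : (forall s, A s -> g s = g' s) ->
  lip_at A g t -> lip_at A g' t.
Proof.
move=> gg' [e e0 [k gk]]; exists e => //; exists k => s s' As As' se s'e.
by rewrite -!gg'//; exact: gk.
Qed.

(** The clamped summands make the concatenation [g] on the first half and [h]
    on the second a plain sum, so that its continuity needs no gluing. *)
(** [g] run on the first half of the unit interval and [h] on the second. The
    clamped terms are constant on the half that does not concern them, so
    that a plain sum does the job and its continuity is immediate. *)
Definition concat g h t : 'rV[R]_N :=
  (g \o clamp 0 1) (affine 2 0 t) + (h \o clamp 0 1) (affine 2 (-1) t) - h 0.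

Lemma concat_left g h t : 0 <= t <= 1 / 2 -> concat g h t = g (affine 2 0 t).
Proof.
move=> /andP[t0 t1]; rewrite /concat /=.
have -> : clamp 0 1 (affine 2 (-1) t) = 0.
  by apply: clamp_left => //; rewrite /affine; lra.
by rewrite clamp_id ?addrK//; rewrite /affine; apply/andP; split; lra.
Qed.

Lemma concat_right g h t : g 1 = h 0 -> 1 / 2 <= t <= 1 ->
  concat g h t = h (affine 2 (-1) t).
Proof.
move=> gh /andP[t0 t1]; rewrite /concat /=.
have -> : clamp 0 1 (affine 2 0 t) = 1.
  by apply: clamp_right => //; rewrite /affine; lra.
rewrite gh [X in X - _]addrC addrK clamp_id//.
by rewrite /affine; apply/andP; split; lra.
Qed.

Lemma affine_continuous k r : continuous (affine k r).
Proof. exact: lipschitz_continuous (affine_dist k r). Qed.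

(** The two halves have to be glued only when they meet outside the wells,
    and then both are Lipschitz near the meeting time. *)
Lemma LipZ_concat g h : LipZ W g -> LipZ W h -> g 1 = h 0 -> LipZ W (concat g h).
Proof.
move=> Zg Zh gh; apply/LipZP; split.
  apply: continuous_subspaceT => t.
  have cclamp f : LipZ W f -> continuous (f \o clamp 0 1).
    by move=> Zf; exact: LipZ_clamp_continuous Zf.
  apply: cvgB; last exact: cvg_cst.
  apply: cvgD.
    exact: (@cvg_comp _ _ _ (affine 2 0) _ _ _ _ (affine_continuous (x := t)) (cclamp _ Zg _)).
  exact: (@cvg_comp _ _ _ (affine 2 (-1)) _ _ _ _ (affine_continuous (x := t)) (cclamp _ Zh _)).
move=> t tA; have /nonzero_timesP[/andP[t0 t1] Wt] := tA.
have n2 : 0 < `|2| :> R by rewrite normr_gt0.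
move: (Zg) => /LipZP[_ lg]; move: (Zh) => /LipZP[_ lh].
apply: (lip_at_glue (m := 1 / 2)) => // tm.
- apply: (@lip_at_eq _ (g \o affine 2 0)).
    by move=> s [/nonzero_timesP[/andP[? ?] _] /= ?]; apply/esym/concat_left/andP.
  apply: (lip_at_comp n2 (affine_dist 2 0) (A := nonzero_times W g)).
    move=> s [/nonzero_timesP[/andP[s0 s1] Ws] /= sm]; apply/nonzero_timesP; split.
      by rewrite /affine; apply/andP; split; lra.
    by rewrite -(concat_left g h)//; apply/andP.
  apply: lg; apply/nonzero_timesP; split.
    by rewrite /affine; apply/andP; split; lra.
  by rewrite -(concat_left g h)//; apply/andP.
- apply: (@lip_at_eq _ (h \o affine 2 (-1))).
    by move=> s [/nonzero_timesP[/andP[? ?] _] /= ?]; apply/esym/(concat_right gh)/andP.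
  apply: (lip_at_comp n2 (affine_dist 2 (-1)) (A := nonzero_times W h)).
    move=> s [/nonzero_timesP[/andP[s0 s1] Ws] /= sm]; apply/nonzero_timesP; split.
      by rewrite /affine; apply/andP; split; lra.
    by rewrite -(concat_right gh)//; apply/andP.
  apply: lh; apply/nonzero_timesP; split.
    by rewrite /affine; apply/andP; split; lra.
  by rewrite -(concat_right gh)//; apply/andP.
Qed.

Lemma energy_concat g h : LipZ W g -> LipZ W h -> g 1 = h 0 ->
  energy W (concat g h) = (energy W g + energy W h)%E.
Proof.
move=> Zg Zh gh; have Zc := LipZ_concat Zg Zh gh.
have h0 : 0 <= 1 / 2 :> R by lra.
have h1 : 1 / 2 <= 1 :> R by lra.
have n2 : 2 != 0 :> R by rewrite pnatr_eq0.
have arc_left : arc W (concat g h) 0 (1 / 2) = arc W g 0 1.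
  transitivity (arc W (g \o affine 2 0) 0 (1 / 2)).
    apply: eq_arc => t t01; apply: integrand_near; near=> s.
    have /andP[? ?] : 0 < s < 1 / 2 by near: s; exact: near_itv.
    by apply: concat_left; apply/andP; split; apply: ltW.
  apply: (arc_affine W_cont n2 _ Zg (lexx 0) (lexx 1)) => t.
  by rewrite /affine; apply/idP/idP => /andP[? ?]; apply/andP; split; lra.
have arc_right : arc W (concat g h) (1 / 2) 1 = arc W h 0 1.
  transitivity (arc W (h \o affine 2 (-1)) (1 / 2) 1).
    apply: eq_arc => t t01; apply: integrand_near; near=> s.
    have /andP[? ?] : 1 / 2 < s < 1 by near: s; exact: near_itv.
    by apply: (concat_right gh); apply/andP; split; apply: ltW.
  apply: (arc_affine W_cont n2 _ Zh (lexx 0) (lexx 1)) => t.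
  by rewrite /affine; apply/idP/idP => /andP[? ?]; apply/andP; split; lra.
apply: (etrans (LipZ_energy W_cont Zc)).
apply: (etrans (arcD W_cont Zc (lexx 0) h0 h1 (lexx 1))).
by rewrite arc_left arc_right (LipZ_energy W_cont Zg) (LipZ_energy W_cont Zh).
Unshelve. all: by end_near. Qed.

End Triangle.

(** * The distance is finite and satisfies the triangle inequality *)

Section Distance.
Context {R : realType} {N : nat}.
Variable W : 'rV[R]_N -> R.
Hypothesis W_cont : continuous W.
Local Notation mu := (@lebesgue_measure R).
Implicit Types (g : R -> 'rV[R]_N) (x y z : 'rV[R]_N) (t k r : R).

Lemma sqrtW_continuous : continuous (Num.sqrt \o W).
Proof.
move=> x; apply: (@continuous_comp _ _ _ W Num.sqrt); first exact: W_cont.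
exact: sqrt_continuous.
Qed.

Definition segment x y t : 'rV[R]_N := t *: (y - x) + x.

Lemma segmentB x y s t : segment x y s - segment x y t = (s - t) *: (y - x).
Proof. by rewrite /segment opprD addrACA subrr addr0 scalerBl. Qed.

Lemma segment_continuous x y : continuous (segment x y).
Proof.
move=> t; apply: cvgD; last exact: cvg_cst.
by apply: cvgZl; exact: cvg_id.
Qed.

Lemma segment_derive1 x y t : derive1 (segment x y) t = y - x.
Proof.
rewrite /derive1; apply: cvg_lim => //; apply: cvg_near_cst; near=> h.
rewrite segmentB addrK scalerA mulVf ?scale1r//.
by near: h; exact: nbhs_dnbhs_neq.
Unshelve. all: by end_near. Qed.

Lemma LipZ_segment x y : LipZ W (segment x y).
Proof.
apply/LipZP; split; first exact/continuous_subspaceT/segment_continuous.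
move=> t _; exists 1 => //; exists (enorm (y - x)) => s s' _ _ _ _.
by rewrite segmentB enormZ mulrC.
Qed.

Lemma lebesgue_measure01 : mu `]0, 1[%classic = 1%E.
Proof. by rewrite lebesgue_measure_itv/= lte_fin ltr01 -EFinB subr0. Qed.

Lemma energy_le g (M : R) : LipZ W g -> 0 <= M ->
  (forall t, 0 < t < 1 -> integrand W g t <= M) -> (energy W g <= M%:E)%E.
Proof.
move=> Zg M0 gM; rewrite (LipZ_energy W_cont Zg) /arc.
have m01 : measurable (`]0, 1[%classic : set (measurableTypeR R)).
  exact: measurable_itv.
have mg := LipZ_eintegrand_measurable W_cont Zg (lexx 0) (lexx 1).
apply: (@le_trans _ _ (\int[mu]_(t in `]0%R, 1%R[) (cst M%:E) t)%E).
  apply: (ge0_le_integral _ m01 _ mg) => [t _|//|t].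
  - by rewrite lee_fin integrand_ge0.
  - by rewrite /= in_itv/= lee_fin => /gM.
by rewrite integral_cst// [X in (_ * X)%E]lebesgue_measure01 mule1.
Qed.

Lemma wdist_le_segment x y M : (forall t, 0 <= t <= 1 -> Num.sqrt (W (segment x y t)) <= M) ->
  (wdist W x y <= (M * enorm (y - x))%:E)%E.
Proof.
move=> WM; have M0 : 0 <= M.
  by apply: le_trans (WM 0 _); rewrite ?sqrtr_ge0// lexx ler01.
apply: (@le_trans _ _ (energy W (segment x y))).
  apply: wdist_le_energy; first exact: LipZ_segment.
    by rewrite /segment scale0r add0r.
  by rewrite /segment scale1r subrK.
apply: energy_le; first exact: LipZ_segment.
  by rewrite mulr_ge0 ?enorm_ge0.
move=> t /andP[t0 t1]; rewrite /integrand segment_derive1 ler_wpM2r ?enorm_ge0//.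
by apply: WM; rewrite !ltW.
Qed.

Lemma wdist_fin x y : wdist W x y \is a fin_num.
Proof.
rewrite ge0_fin_numE; last exact: wdist_ge0.
have [|c _ cM] := @EVT_max R (Num.sqrt \o W \o segment x y) 0 1 ler01.
  apply: continuous_subspaceT => t.
  apply: (@continuous_comp _ _ _ (segment x y) (Num.sqrt \o W)).
    exact: segment_continuous.
  exact: sqrtW_continuous.
apply: le_lt_trans (wdist_le_segment _) (ltry _); last first.
  by move=> t t01; apply: (cM t); rewrite in_itv.
Qed.

Lemma wdist_triangle x y z : (wdist W x z <= wdist W x y + wdist W y z)%E.
Proof.
apply/lee_addgt0Pr => e e0; have e20 : 0 < e / 2 by rewrite divr_gt0.
have [_ [g [Zg gx gy] <-] ge] := lb_ereal_inf_adherent e20 (wdist_fin x y).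
have [_ [h [Zh hy hz] <-] he] := lb_ereal_inf_adherent e20 (wdist_fin y z).
have gh : g 1 = h 0 by rewrite gy hy.
apply: (@le_trans _ _ (energy W g + energy W h)%E).
  rewrite -(energy_concat W_cont Zg Zh gh); apply: wdist_le_energy.
  - exact: LipZ_concat.
  - rewrite (concat_left g h); last by apply/andP; split; lra.
    by rewrite /affine mulr0 addr0.
  - rewrite (concat_right gh); last by apply/andP; split; lra.
    by rewrite /affine -hz; congr h; lra.
apply: le_trans (leeD (ltW ge) (ltW he)) _.
by rewrite addeACA -EFinD -splitr.
Qed.

Definition dist x y : R := fine (wdist W x y).

Lemma distE x y : (dist x y)%:E = wdist W x y.
Proof. by rewrite /dist fineK// wdist_fin. Qed.

Lemma dist_ge0 x y : 0 <= dist x y.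
Proof. by rewrite -lee_fin distE wdist_ge0. Qed.

Lemma distC x y : dist x y = dist y x.
Proof. by rewrite /dist wdistC. Qed.

Lemma dist_triangle y x z : dist x z <= dist x y + dist y z.
Proof. by rewrite -lee_fin EFinD !distE wdist_triangle. Qed.

Lemma dist_abs x y z : `|dist z x - dist z y| <= dist x y.
Proof.
have := dist_triangle x z y; have := dist_triangle y z x; rewrite (distC y x).
by rewrite ler_norml; lra.
Qed.

End Distance.

(** * Lower bounds for the energy and the distance *)

Section LowerBound.
Context {R : realType} {N : nat}.
Variable W : 'rV[R]_N -> R.
Hypothesis W_cont : continuous W.
Local Notation mu := (@lebesgue_measure R).
Implicit Types (g : R -> 'rV[R]_N) (x y z v : 'rV[R]_N) (a b t k r : R).

(** The displacement [v] is the integral of the derivative. Pairing with the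
    vector of norm [c] in the direction of [v] gives [c * enorm v] on one
    side and, by Cauchy-Schwarz, at most [c] times the integral of the speed
    on the other. *)
Lemma lipschitz_enorm_le_arc g a b c k : LipZ W g -> 0 <= a -> a <= b -> b <= 1 ->
  (forall s t, a <= s <= b -> a <= t <= b -> enorm (g s - g t) <= k * `|s - t|) ->
  0 < c -> (forall t, a <= t <= b -> c <= Num.sqrt (W (g t))) ->
  ((c * enorm (g b - g a))%:E <= arc W g a b)%E.
Proof.
move=> Zg a0 ab b1 gk c0 Wc.
set v := g b - g a.
have [v0|v0] := eqVneq (enorm v) 0; first by rewrite v0 mulr0 arc_ge0.
have ftc i : exists h : R -> R, [/\ mu.-integrable `[a, b] (EFin \o h),
    {ae mu, forall t, a < t < b -> is_derive t 1 (fun s => g s ord0 i) (h t)} &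
    \int[mu]_(t in `[a, b]) h t = v ord0 i].
  have fk (s t : R) : a <= s <= b -> a <= t <= b ->
      `|g s ord0 i - g t ord0 i| <= k * `|s - t|.
    move=> sab tab; apply: le_trans (gk _ _ sab tab).
    by have := coord_le_enorm (g s - g t) i; rewrite !mxE.
  have [h [h1 h2 h3]] := lipschitz_ftc fk ab.
  by exists h; split=> //; rewrite h3 /v !mxE.
have [h hP] := choice ftc.
have hint i : mu.-integrable `[a, b] (EFin \o h i) by case: (hP i).
have hder i : {ae mu, forall t, a < t < b -> is_derive t 1 (fun s => g s ord0 i) (h i t)}.
  by case: (hP i).
have hE i : \int[mu]_(t in `[a, b]) h i t = v ord0 i by case: (hP i).
have mab : measurable (`[a, b]%classic : set (measurableTypeR R)).
  exact: measurable_itv.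
pose u := (c / enorm v) *: v.
pose H t := \sum_(i < N) u ord0 i * h i t.
have uc : enorm u = c.
  by rewrite enormZ ger0_norm ?divr_ge0 ?(ltW c0) ?enorm_ge0// divfK.
have Hint : mu.-integrable `[a, b] (EFin \o H).
  have -> : EFin \o H = (fun t => \sum_(i < N) (u ord0 i)%:E * (EFin \o h i) t)%E.
    by apply/funext => t; rewrite /= /H sumEFin.
  by apply: (integrable_sum mab) => i _; exact: (integrableZl mab _ (hint i)).
have hiE i : (\int[mu]_(t in `[a, b]) (h i t)%:E)%E = (v ord0 i)%:E.
  by rewrite -hE /Rintegral fineK//; exact: (integrable_fin_num mab (hint i)).
have HE : (\int[mu]_(t in `[a, b]) (H t)%:E)%E = (c * enorm v)%:E.
  transitivity (\int[mu]_(t in `[a, b])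
      (\sum_(i < N) (u ord0 i)%:E * (EFin \o h i) t))%E.
    by apply: eq_integral => t _; rewrite /H -sumEFin.
  rewrite (integral_sum mab) => [|i]; last exact: (integrableZl mab _ (hint i)).
  transitivity (\sum_(i < N) (u ord0 i * v ord0 i)%:E)%E.
    apply: eq_bigr => i _; rewrite (integralZl mab (hint i)) EFinM.
    by congr (_ * _)%E; exact: hiE.
  rewrite sumEFin; congr EFin.
  transitivity (c / enorm v * dot v v).
    by rewrite /dot mulr_sumr; apply: eq_bigr => i _; rewrite mxE mulrA.
  by rewrite -sqr_enorm expr2 mulrA divfK.
rewrite -HE; apply: le_trans (lee_abs _) _.
apply: le_trans (le_abse_integral mu mab _) _; first exact: measurable_int Hint.
have mH : measurable_fun (`]a, b[%classic : set (measurableTypeR R))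
    (fun t => `|(H t)%:E|%E).
  apply: measurableT_comp => //; apply: measurable_funS (measurable_int _ Hint) => //.
  exact: subset_itv_oo_cc.
rewrite (integral_itv_bndoo true false mH).
have mabo : measurable (`]a, b[%classic : set (measurableTypeR R)).
  exact: measurable_itv.
have mg := LipZ_eintegrand_measurable W_cont Zg a0 b1.
apply: (ae_ge0_le_integral mabo _ mH _ mg) => [t _|t _|].
- exact: abse_ge0.
- by rewrite lee_fin integrand_ge0.
have : {ae mu, forall t, forall i, a < t < b ->
    is_derive t 1 (fun s => g s ord0 i) (h i t)}.
  by apply: filter_forall.
apply: filterS; first exact: (ae_filter_ringOfSetsType mu).
move=> t ht; rewrite /= in_itv/= => tab.
have gt i : is_derive t 1 (fun s => g s ord0 i) (h i t) by exact: ht.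
have gd : derivable g t 1 by apply/derivable_rowP => i; case: (gt i).
have -> : H t = dot u (derive1 g t).
  apply: eq_bigr => i _; rewrite derive1_coord// derive1E.
  by case: (gt i) => _ ->.
rewrite /= lee_fin; apply: le_trans (cauchy_schwarz_abs _ _) _.
rewrite uc ler_wpM2r ?enorm_ge0//.
by apply: Wc; move: tab => /andP[? ?]; rewrite !ltW.
Qed.

(** A curve that avoids the wells is only locally Lipschitz, but the
    inequality propagates from short arcs to concatenated ones by the triangle
    inequality on the left and additivity on the right. *)
Lemma enorm_le_arc g a b c : LipZ W g -> 0 <= a -> a <= b -> b <= 1 ->
  0 < c -> (forall t, a <= t <= b -> c <= Num.sqrt (W (g t))) ->
  ((c * enorm (g b - g a))%:E <= arc W g a b)%E.
Proof.
move=> Zg a0 ab b1 c0 Wc.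
pose P (u v : R) := ((c * enorm (g v - g u))%:E <= arc W g u v)%E.
apply: (@cousin_chain _ P) => // [u v w au uv vw wb Puv Pvw|t tab].
  have u0 : 0 <= u by lra.
  have w1 : w <= 1 by lra.
  rewrite /P (arcD W_cont Zg u0 uv vw w1).
  apply: le_trans (leeD Puv Pvw); rewrite -EFinD lee_fin -mulrDr.
  by rewrite ler_wpM2l ?(ltW c0)// [leRHS]addrC (enorm_distD (g v)).
have nz s : a <= s <= b -> nonzero_times W g s.
  move=> sab; apply/nonzero_timesP; split.
    by move: sab => /andP[? ?]; apply/andP; split; lra.
  by move=> W0; have := Wc s sab; rewrite W0 sqrtr0 leNgt c0.
move: (Zg) => /LipZP[_ /(_ t (nz t tab))[e e0 [k gk]]].
exists e => // u v au vb ut ut' tv vt.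
apply: (@lipschitz_enorm_le_arc g u v c k) => //; try lra.
- move=> s s' /andP[? ?] /andP[? ?]; apply: gk.
  + by apply: nz; apply/andP; split; lra.
  + by apply: nz; apply/andP; split; lra.
  + by rewrite ltr_norml; apply/andP; split; lra.
  + by rewrite ltr_norml; apply/andP; split; lra.
- by move=> s /andP[? ?]; apply: Wc; apply/andP; split; lra.
Qed.

(** Follow a curve from [x] until its distance to [x] first equals the
    minimum: up to that time it stays in the ball where [c] bounds the weight
    from below. *)
Lemma dist_lower_bound x y c r : 0 < c -> 0 <= r ->
  (forall z, enorm (z - x) <= r -> c <= Num.sqrt (W z)) ->
  c * Num.min (enorm (x - y)) r <= dist W x y.
Proof.
move=> c0 r0 Wc; rewrite -lee_fin (distE W_cont).
apply: le_ereal_inf_tmp => _ [g [Zg gx gy] <-].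
pose f t := enorm (g (clamp 0 1 t) - x).
have cf : continuous f.
  move=> t; apply: (@continuous_comp _ _ _ (fun t => g (clamp 0 1 t) - x) (@enorm R N)).
    by apply: cvgB; [exact: (LipZ_clamp_continuous _ _ _ Zg)|exact: cvg_cst].
  exact: enorm_continuous.
set m := Num.min _ _.
have [||t [/andP[t0 t1] ft fs]] := @first_hit _ f m cf.
- by rewrite /f clamp_left// gx subrr enorm0 le_min enorm_ge0.
- by rewrite /f clamp_right// gy ge_min enormBC lexx.
have ct s : 0 <= s <= t -> clamp 0 1 s = s.
  by move=> /andP[? ?]; rewrite clamp_id//; apply/andP; split; lra.
rewrite (LipZ_energy W_cont Zg) (arcD W_cont Zg (lexx 0) t0 t1 (lexx 1)).
apply: (@le_trans _ _ (arc W g 0 t)); last by rewrite leeDl// arc_ge0.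
have -> : m = enorm (g t - g 0) by rewrite -ft /f ct ?gx// t0 lexx.
apply: enorm_le_arc => // s st; apply: Wc.
have := fs s st; rewrite /f ct// => /le_trans; apply.
by rewrite /m ge_min lexx orbT.
Qed.
End LowerBound.

(** * Comparison of the topologies *)

Section DistanceTopology.
Context {R : realType} {N m : nat}.
Variables (W : 'rV[R]_N -> R) (well : 'I_m -> 'rV[R]_N).
Hypothesis W_ge0 : forall x, 0 <= W x.
Hypothesis W_cont : continuous W.
Hypothesis W_zeros : zero_set W = range well.
Hypothesis W_infty : (0 < limf_einf (fun x => (W x)%:E) at_infinity)%E.
Implicit Types (x y z : 'rV[R]_N) (c e r : R).

Lemma sqrtW_near x e : 0 < e -> exists2 r, 0 < r &
  forall z, enorm (x - z) < r -> `|Num.sqrt (W x) - Num.sqrt (W z)| < e.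
Proof.
move=> e0; have cF := sqrtW_continuous W_cont.
have /cvgrPdist_lt/(_ e e0) := cF x.
by move=> /nbhs_enormP[r r0 rP]; exists r.
Qed.

Lemma sqrtW_gt0 x : W x <> 0 -> 0 < Num.sqrt (W x).
Proof. by move=> /eqP Wx; rewrite sqrtr_gt0 lt0r Wx W_ge0. Qed.

(** A short segment costs at most its length times a local bound of the
    weight. *)
Lemma dist_continuous_at x e : 0 < e -> exists2 d, 0 < d &
  forall y, enorm (x - y) < d -> dist W x y < e.
Proof.
move=> e0; have [r r0 rP] := sqrtW_near x ltr01.
pose M := Num.sqrt (W x) + 1.
have M0 : 0 < M by rewrite ltr_wpDl ?sqrtr_ge0.
exists (Num.min r (e / M)); first by rewrite lt_min r0 divr_gt0.
move=> y; rewrite lt_min => /andP[xyr xye].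
apply: (@le_lt_trans _ _ (M * enorm (y - x))); last first.
  by rewrite mulrC -ltr_pdivlMr// enormBC.
rewrite -lee_fin (distE W_cont); apply: wdist_le_segment => // t /andP[t0 t1].
have : enorm (x - segment x y t) < r.
  rewrite enormBC /segment addrK enormZ enormBC ger0_norm//.
  by apply: le_lt_trans xyr; rewrite ler_piMl ?enorm_ge0.
by move=> /rP; rewrite ltr_norml /M; lra.
Qed.

Lemma dist_xx x : dist W x x = 0.
Proof.
apply/le_anti; rewrite (dist_ge0 W_cont) andbT.
rewrite -lee_fin (distE W_cont).
apply: le_trans (@wdist_le_segment _ _ W W_cont x x (Num.sqrt (W x)) _) _.
  by move=> t _; rewrite /segment subrr scaler0 add0r.
by rewrite subrr enorm0 mulr0.
Qed.

(** Any curve from [x] to [y] crosses the sphere of radius [r] around [x]. *)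
Lemma dist_sphere x y K r : 0 <= r <= enorm (x - y) ->
  (forall z, enorm (x - z) = r -> K <= dist W x z) -> K <= dist W x y.
Proof.
move=> /andP[r0 rxy] Kr; rewrite -lee_fin (distE W_cont).
apply: le_ereal_inf_tmp => _ [g [Zg gx gy] <-].
pose f t := enorm (x - g (clamp 0 1 t)).
have cf : continuous f.
  move=> t; apply: (@continuous_comp _ _ _ (fun t => x - g (clamp 0 1 t)) (@enorm R N)).
    by apply: cvgB; [exact: cvg_cst|exact: (LipZ_clamp_continuous _ _ _ Zg)].
  exact: enorm_continuous.
have [||t [/andP[t0 t1] ft _]] := @first_hit _ f r cf.
- by rewrite /f clamp_left// gx subrr enorm0.
- by rewrite /f clamp_right// gy.
rewrite (LipZ_energy W_cont Zg) (arcD W_cont Zg (lexx 0) t0 t1 (lexx 1)).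
apply: (@le_trans _ _ (arc W g 0 t)); last by rewrite leeDl// arc_ge0.
apply: le_trans (wdist_le_arc W_cont Zg (lexx 0) t0 t1).
rewrite gx -(distE W_cont) lee_fin; apply: Kr.
by rewrite -ft /f clamp_id// t0.
Qed.

(** This is where the finiteness of the zero set enters. *)
Lemma wells_isolated x : exists2 e, 0 < e &
  forall z, enorm (x - z) < e -> z <> x -> W z <> 0.
Proof.
have : \forall z \near x, forall i, z <> x -> z <> well i.
  apply: (filter_forall (F := nbhs x)) => i.
  have [wx|/eqP wx] := eqVneq (well i) x; first by near=> z; rewrite wx.
  apply/nbhs_enormP; exists (enorm (x - well i)).
    rewrite lt0r enorm_ge0 andbT; apply/eqP => /enorm_eq0/eqP.
    by rewrite subr_eq0 eq_sym => /eqP.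
  by move=> z xz _ zi; move: xz; rewrite zi ltxx.
move=> /nbhs_enormP[e e0 eP]; exists e => // z xz zx Wz.
have : zero_set W z by [].
by rewrite W_zeros => -[i _ zi]; exact: (eP z xz i zx).
Unshelve. all: by end_near. Qed.

(** A curve leaving the ball crosses a sphere around [x] that is contained in
    an annulus without wells. By compactness some [c > 0] bounds the weight
    from below on the annulus, and [dist_lower_bound], centred at the crossing
    point, makes the crossing cost at least [c] times half the radius. *)
Lemma dist_separates x e : 0 < e -> exists2 d, 0 < d &
  forall y, dist W x y < d -> enorm (x - y) < e.
Proof.
move=> e0; have [e1 e10 e1P] := wells_isolated x.
(* With this radius the annulus [r / 2 <= enorm (x - z) <= 3 r / 2] stays
   within distance [e1] of [x], hence contains no well. *)
pose r := Num.min e e1 / 2.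
have me : 0 < Num.min e e1 by rewrite lt_min e0.
have r0 : 0 < r by rewrite divr_gt0.
have re : r < e.
  apply: (@lt_le_trans _ _ (Num.min e e1)); last by rewrite ge_min lexx.
  by rewrite /r; lra.
have re1 : r * 3 / 2 < e1.
  apply: (@lt_le_trans _ _ (Num.min e e1)); last by rewrite ge_min lexx orbT.
  by rewrite /r; lra.
pose A := [set z | enorm (x - z) <= r * 3 / 2] `&` [set z | r / 2 <= enorm (x - z)].
have [c c0 Ac] : exists2 c, 0 < c & forall z, A z -> c <= Num.sqrt (W z).
  have [A0|/set0P/negP/negPn/eqP A0] := pselect (A !=set0); last first.
    by exists 1 => // z; rewrite A0.
  have cA : compact A.
    have cB := enorm_closed_ball_compact (x := x) (r := r * 3 / 2).
    apply: (subclosed_compact _ cB); last by move=> ? [].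
    by apply: closedI; [exact: enorm_ball_closed|exact: enorm_coball_closed].
  have [|z zA zmin] := @compact_EVT_min _ R (Num.sqrt \o W) A A0 cA.
    by apply: continuous_subspaceT => z; exact: sqrtW_continuous.
  exists (Num.sqrt (W z)); last by move=> y yA; apply: zmin; rewrite inE.
  move: zA; rewrite inE => -[/= zr rz]; apply/sqrtW_gt0/e1P.
    exact: le_lt_trans re1.
  by move=> zx; move: rz; rewrite zx subrr enorm0; lra.
exists (c * (r / 2)); first by rewrite mulr_gt0// divr_gt0.
move=> y; apply: contraTT; rewrite -!leNgt => exy.
apply: (@dist_sphere x y _ r).
  by rewrite ltW//= (le_trans (ltW re)).
move=> z xz; rewrite (distC W_cont).
have -> : r / 2 = Num.min (enorm (z - x)) (r / 2).
  by rewrite min_r// enormBC xz; lra.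
apply: dist_lower_bound => //; first by lra.
move=> w wz; apply: Ac; split=> /=.
  have := enorm_distD z x w; rewrite (enormBC z w); lra.
have := enorm_distD w x z; lra.
Qed.

Lemma W_infty_lower : exists2 c, 0 < c & exists M : R,
  forall z, M < enorm z -> c <= Num.sqrt (W z).
Proof.
have := W_infty; rewrite limf_einfE => /ereal_sup_gt[_ [V [M VM] <-] V0].
have Vle z : V z -> (ereal_inf [set (W x)%:E | x in V] <= (W z)%:E)%E.
  by move=> Vz; apply: ereal_inf_lbound; exists z.
move: V0 Vle; case: (ereal_inf _) => [s||] //.
- rewrite lte_fin => s0 Vle; exists (Num.sqrt s); first by rewrite sqrtr_gt0.
  by exists M => z /VM/Vle; rewrite lee_fin => ?; exact: ler_wsqrtr.
- by move=> _ Vle; exists 1 => //; exists M => z /VM/Vle.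
Qed.

(** A point far from the origin is the centre of a large ball on which the
    weight is at least [c], and leaving this ball costs more than [C]. *)
Lemma dist_bounded x C : exists M : R, forall y, dist W x y <= C -> enorm (x - y) <= M.
Proof.
have [c c0 [M WM]] := W_infty_lower.
(* Leaving a ball of this radius costs [c * r], which exceeds [C]. *)
pose r := (`|C| + 1) / c.
have r0 : 0 < r by rewrite divr_gt0// ltr_wpDl.
exists (`|M| + enorm x + r) => y; apply: contraTT; rewrite -!ltNge => xy.
have Mp := ler_norm M; have M0 := normr_ge0 M; have x0 := enorm_ge0 x.
have ball z : enorm (z - y) <= r -> c <= Num.sqrt (W z).
  move=> zy; apply: WM.
  have := enorm_distD y x 0; have := enorm_distD z y 0.
  have := enorm_distD 0 x y; rewrite !subr0 sub0r enormN (enormBC y z); lra.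
rewrite (distC W_cont); apply: lt_le_trans (dist_lower_bound W_cont x c0 (ltW r0) ball).
rewrite min_r; last by rewrite enormBC; lra.
by rewrite /r mulrC divfK ?gt_eqF// (le_lt_trans (ler_norm C))// ltrDl.
Qed.

End DistanceTopology.

(** * Existence of a curve that is Lipschitz for the distance *)

Section Minimizer.
Context {R : realType} {N m : nat}.
Variables (W : 'rV[R]_N -> R) (well : 'I_m -> 'rV[R]_N).
Hypothesis W_ge0 : forall x, 0 <= W x.
Hypothesis W_cont : continuous W.
Hypothesis W_zeros : zero_set W = range well.
Hypothesis W_infty : (0 < limf_einf (fun x => (W x)%:E) at_infinity)%E.
Implicit Types (x y z p q : 'rV[R]_N) (c e r s t : R).

Lemma dist_continuous p : continuous (dist W p).
Proof.
move=> x; apply/(@cvgrPdist_lt _ R^o _ (nbhs x)) => e e0.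
have [d d0 dP] := dist_continuous_at W_cont x e0.
apply/nbhs_enormP; exists d => // y /dP; apply: le_lt_trans.
exact: dist_abs.
Qed.

Lemma dist_eq0 x y : dist W x y = 0 -> x = y.
Proof.
move=> xy0; apply/eqP; rewrite -subr_eq0; apply/eqP/enorm_eq0/le_anti.
rewrite enorm_ge0 andbT; apply/ler_addgt0Pr => e e0; rewrite add0r.
have [d d0 dP] := dist_separates W_ge0 W_cont W_zeros x e0.
by apply/ltW/dP; rewrite xy0.
Qed.

Lemma three_arcs_le_energy (g : R -> 'rV[R]_N) s t : LipZ W g ->
  0 <= s -> s <= t -> t <= 1 ->
  ((dist W (g 0) (g s) + dist W (g s) (g t) + dist W (g t) (g 1))%:E <= energy W g)%E.
Proof.
move=> Zg s0 st t1; have t0 : 0 <= t by rewrite (le_trans s0).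
rewrite (LipZ_energy W_cont Zg) (arcD W_cont Zg (lexx 0) t0 t1 (lexx 1)).
rewrite (arcD W_cont Zg (lexx 0) s0 st t1) !EFinD !(distE W_cont).
have arc1 := wdist_le_arc W_cont Zg (lexx 0) s0 (le_trans st t1).
have arc2 := wdist_le_arc W_cont Zg s0 st t1.
have arc3 := wdist_le_arc W_cont Zg t0 t1 (lexx 1).
exact: (leeD (leeD arc1 arc2) arc3).
Qed.

(** Let [l] be the distance from [p] to [q] and [g] a curve of energy less
    than [l + e]. Pick [h t] on [g] at distance [l * t] from [p]. If [g] meets
    [h s] before [h t], the arcs before [h s] and after [h t] have energy at
    least [l * s] and [l - l * t], so at most [l * (t - s) + e] remains for
    the arc in between; the opposite order is symmetric. *)
Lemma almost_geodesic p q e : 0 < e -> exists h : R -> 'rV[R]_N,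
  [/\ h 0 = p, h 1 = q,
    forall t, 0 <= t <= 1 -> dist W p (h t) = dist W p q * t &
    forall s t, 0 <= s <= 1 -> 0 <= t <= 1 ->
      dist W (h s) (h t) <= dist W p q * `|s - t| + e].
Proof.
move=> e0; set l := dist W p q.
have l0 : 0 <= l by exact: dist_ge0.
have [_ [g [Zg gp gq] <-]] := lb_ereal_inf_adherent e0 (wdist_fin W_cont p q).
rewrite -[ereal_inf _]/(wdist W p q) -(distE W_cont) -EFinD -/l => ge.
have cf : continuous (fun t => dist W p (g (clamp 0 1 t))).
  move=> t; apply: (@continuous_comp _ _ _ (g \o clamp 0 1) (dist W p)).
    exact: (LipZ_clamp_continuous _ _ _ Zg).
  exact: dist_continuous.
(* The distance to [p] does not single out [q], so the endpoint [t = 1] has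
   to be prescribed separately. *)
have hit t : exists z, 0 <= t <= 1 -> exists2 u, 0 <= u <= 1 &
    [/\ g u = z, dist W p z = l * t, t = 0 -> z = p & t = 1 -> z = q].
  have [t01|] := boolP (0 <= t <= 1); last by exists 0.
  have [->|tn1] := eqVneq t 1.
    exists q => _; exists 1; first by rewrite ler01 lexx.
    by split=> //; [rewrite mulr1|move/eqP; rewrite oner_eq0].
  have [] : exists2 u, u \in `[0, 1] & dist W p (g (clamp 0 1 u)) = l * t.
    apply: (@IVT _ (fun t => dist W p (g (clamp 0 1 t)))); first exact: ler01.
      exact: continuous_subspaceT.
    rewrite (clamp_left ler01 (lexx 0)) (clamp_right ler01 (lexx 1)) gp gq.
    rewrite (dist_xx W_cont) -/l.
    move: t01 => /andP[t0 t1].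
    by rewrite ge_min mulr_ge0//= le_max ler_piMr ?orbT.
  move=> u u01 fu.
  move: u01; rewrite in_itv/= => u01.
  exists (g u) => _; exists u => //; split=> //.
  - by rewrite -fu clamp_id.
  - by move=> t0; apply/esym/dist_eq0; rewrite -[u](clamp_id u01) fu t0 mulr0.
  - by move=> t1; rewrite t1 eqxx in tn1.
have [h hP] := choice hit.
exists h.
have I0 : 0 <= (0 : R) <= 1 by rewrite lexx ler01.
have I1 : 0 <= (1 : R) <= 1 by rewrite lexx ler01.
split.
- by have [u _ [_ _ h0 _]] := hP 0 I0; exact: h0.
- by have [u _ [_ _ _ h1]] := hP 1 I1; exact: h1.
- by move=> t /hP[u _ []].
move=> s t /hP[u u01 [us ds _ _]] /hP[v v01 [vt dt _ _]].
have key a b a' b' : 0 <= a <= 1 -> 0 <= b <= 1 -> a <= b ->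
    dist W p (g a) = l * a' -> dist W p (g b) = l * b' ->
    dist W (g a) (g b) <= l * (b' - a') + e.
  move=> /andP[a0 _] /andP[_ b1] ab da db.
  have := three_arcs_le_energy Zg a0 ab b1.
  move=> /le_lt_trans/(_ ge); rewrite gp gq lte_fin da.
  have := dist_triangle W_cont (g b) p q; rewrite db -/l mulrBr; lra.
have [uv|/ltW vu] := leP u v.
  have := key u v s t u01 v01 uv; rewrite us vt => /(_ ds dt) /le_trans; apply.
  by rewrite lerD2r ler_wpM2l// distrC ler_norm.
have := key v u t s v01 u01 vu; rewrite us vt => /(_ dt ds).
rewrite (distC W_cont) => /le_trans; apply.
by rewrite lerD2r ler_wpM2l// ler_norm.
Qed.

(** For an ultrafilter a cluster point is a limit. *)
Lemma ultra_limit (T : topologicalType) (U : set_system nat) (K : set T)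
    (u : nat -> T) : UltraFilter U -> compact K -> (forall n, K (u n)) ->
  exists v : T, u n @[n --> U] --> v.
Proof.
move=> UU cK Ku.
have PU : ProperFilter U by exact: ultra_proper.
have UK : (u n @[n --> U]) K.
  by apply: (@filterS _ U _ setT) => [n _|]; [exact: Ku|exact: filterT].
have [x [_ clx]] := cK _ (fmap_proper_filter u PU) UK.
exists x => B xB; have [//|UnB] := in_ultra_setVsetC (u @^-1` B) UU.
have [y [nBy By]] := clx (~` B) B UnB xB.
by case: nBy.
Qed.

(** A single ultrafilter on the indices makes all the sequences of points
    converge at once, one sequence for each of the uncountably many times. *)
Lemma geodesic p q : exists h : R -> 'rV[R]_N,
  [/\ h 0 = p, h 1 = q & forall s t, 0 <= s <= 1 -> 0 <= t <= 1 ->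
      dist W (h s) (h t) <= dist W p q * `|s - t|].
Proof.
set l := dist W p q.
have l0 : 0 <= l by exact: dist_ge0.
have invS0 (n : nat) : 0 < n.+1%:R^-1 :> R by rewrite invr_gt0.
have [u uP] := choice (fun n => almost_geodesic p q (invS0 n)).
have [M MP] := dist_bounded W_cont W_infty p l.
have [U [UU UF]] := @ultraFilterLemma nat \oo _.
have PU : ProperFilter U by exact: ultra_proper.
have lim t : exists z, 0 <= t <= 1 -> u n t @[n --> U] --> z.
  have [t01|] := boolP (0 <= t <= 1); last by exists 0.
  have cB := enorm_closed_ball_compact (x := p) (r := M).
  have [|z uz] := ultra_limit (u := u ^~ t) UU cB.
    move=> n /=; apply: MP; have [_ _ -> // _] := uP n.
    by move: t01 => /andP[t0 t1]; rewrite -/l ler_piMr.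
  by exists z.
have [h hP] := choice lim.
have h_near t e : 0 <= t <= 1 -> 0 < e -> U [set n | dist W (h t) (u n t) < e].
  move=> t01 e0; have [d d0 dP] := dist_continuous_at W_cont (h t) e0.
  have := hP t t01 [set y | dist W (h t) y < e]; apply.
  by apply/nbhs_enormP; exists d.
have h_end t z : 0 <= t <= 1 -> (forall n, u n t = z) -> h t = z.
  move=> t01 uz; apply: dist_eq0; apply/le_anti; rewrite (dist_ge0 W_cont) andbT.
  apply/ler_addgt0Pr => e e0; rewrite add0r.
  have [n /=] := filter_ex (h_near t e t01 e0).
  by rewrite uz => /ltW.
exists h; split.
- by apply: h_end => [|n]; [rewrite lexx ler01|case: (uP n)].
- by apply: h_end => [|n]; [rewrite lexx ler01|case: (uP n)].
move=> s t s01 t01; apply/ler_addgt0Pr => e e0.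
have e30 : 0 < e / 3 by rewrite divr_gt0.
have [k ke] := exists_invS_lt e30.
have Uk : U [set n | (k <= n)%N] by apply: UF; exists k.
have Us := h_near s _ s01 e30; have Ut := h_near t _ t01 e30.
have [n [[/= nk ns] nt]] := filter_ex (filterI (filterI Uk Us) Ut).
have [_ _ _ /(_ s t s01 t01)] := uP n.
have nke : n.+1%:R^-1 < e / 3.
  by apply: le_lt_trans ke; rewrite lef_pV2 ?posrE// ler_nat ltnS.
have := dist_triangle W_cont (u n s) (h s) (h t).
have := dist_triangle W_cont (u n t) (u n s) (h t).
move: nke ns nt; rewrite /= (distC W_cont (h t)) -/l.
move: (n.+1%:R^-1) => w *; lra.
Qed.

End Minimizer.

(** * Regularity and energy of such a curve *)

Section GeodesicEnergy.
Context {R : realType} {N m : nat}.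
Variables (W : 'rV[R]_N -> R) (well : 'I_m -> 'rV[R]_N).
Hypothesis W_ge0 : forall x, 0 <= W x.
Hypothesis W_cont : continuous W.
Hypothesis W_zeros : zero_set W = range well.
Variables (l : R) (h : R -> 'rV[R]_N).
Hypothesis h_lip : forall s t, 0 <= s <= 1 -> 0 <= t <= 1 ->
  dist W (h s) (h t) <= l * `|s - t|.

Let l_ge0 : 0 <= l.
Proof.
have := @h_lip 0 1; rewrite !lexx ler01 sub0r normrN1 mulr1 => /(_ isT isT).
by apply: le_trans; exact: dist_ge0.
Qed.

Let L := l + 1.
Let L_gt0 : 0 < L. Proof. by rewrite ltr_wpDl. Qed.

Let h_lipL s t : 0 <= s <= 1 -> 0 <= t <= 1 ->
  dist W (h s) (h t) <= L * `|s - t|.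
Proof.
by move=> s01 t01; apply: le_trans (h_lip s01 t01) _; rewrite ler_wpM2r// lerDl.
Qed.

Lemma dist_lipschitz_near t e : 0 <= t <= 1 -> 0 < e ->
  exists2 d, 0 < d & forall s, 0 <= s <= 1 -> `|s - t| < d -> enorm (h t - h s) < e.
Proof.
move=> t01 e0.
have [d d0 dP] := dist_separates W_ge0 W_cont W_zeros (h t) e0.
exists (d / L); first by rewrite divr_gt0.
move=> s s01 st; apply/dP/(le_lt_trans (h_lipL t01 s01)).
by rewrite mulrC -ltr_pdivlMr// distrC.
Qed.

Lemma sqrtW_lower x c : c < Num.sqrt (W x) -> exists2 r, 0 < r &
  forall z, enorm (z - x) <= r -> c <= Num.sqrt (W z).
Proof.
move=> cx; have cx0 : 0 < Num.sqrt (W x) - c by rewrite subr_gt0.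
have [r r0 rP] := sqrtW_near W_cont x cx0.
exists (r / 2); first by rewrite divr_gt0.
move=> z zx; have : enorm (x - z) < r by rewrite enormBC; lra.
by move=> /rP; rewrite ltr_norml; lra.
Qed.

(** Near [t] all the points of the curve lie in a ball on which [c] bounds the
    weight from below, and there [dist_lower_bound] compares [dist] with
    [enorm]. *)
Lemma dist_lipschitz_enorm t c : 0 <= t <= 1 -> 0 < c -> c < Num.sqrt (W (h t)) ->
  exists2 d, 0 < d & forall s s', 0 <= s <= 1 -> 0 <= s' <= 1 ->
    `|s - t| < d -> `|s' - t| < d -> c * enorm (h s - h s') <= l * `|s - s'|.
Proof.
move=> t01 c0 ct; have [r r0 rP] := sqrtW_lower ct.
have r30 : 0 < r / 3 by rewrite divr_gt0.
have [d d0 dP] := dist_lipschitz_near t01 r30.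
exists d => // s s' s01 s'01 /(dP _ s01) st /(dP _ s'01) s't.
apply: le_trans (h_lip s01 s'01).
have ss' : enorm (h s - h s') < r * 2 / 3.
  by have := enorm_distD (h t) (h s) (h s'); rewrite (enormBC (h s) (h t)); lra.
rewrite -[enorm _](@min_l _ _ _ (r * 2 / 3)) ?(ltW ss')//.
apply: dist_lower_bound => //; first lra.
move=> z zs; apply: rP.
by have := enorm_distD (h s) z (h t); rewrite (enormBC (h s) (h t)); lra.
Qed.

Lemma dist_lipschitz_LipZ : LipZ W h.
Proof.
apply/LipZP; split.
  apply/subspace_continuousP => t; rewrite /= in_itv/= => t01 A.
  move=> /nbhs_enormP[e e0 eA].
  have [d d0 dP] := dist_lipschitz_near t01 e0.
  exists d => // s /=; rewrite distrC => st s01.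
  by apply/eA/dP => //; move: s01; rewrite in_itv.
move=> t /nonzero_timesP[t01 Wt].
have F0 := sqrtW_gt0 W_ge0 Wt.
have c0 : 0 < Num.sqrt (W (h t)) / 2 by rewrite divr_gt0.
have ct : Num.sqrt (W (h t)) / 2 < Num.sqrt (W (h t)) by lra.
have [d d0 dP] := dist_lipschitz_enorm t01 c0 ct.
exists d => //; exists (l / (Num.sqrt (W (h t)) / 2)) => s s'.
move=> /nonzero_timesP[s01 _] /nonzero_timesP[s'01 _] st s't.
by rewrite mulrAC ler_pdivlMr// mulrC; exact: dP.
Qed.

(** Divide the estimate of [dist_lipschitz_enorm] by the increment of time and
    pass to the limit. *)
Lemma dist_lipschitz_speed t c : 0 < t < 1 -> derivable h t 1 ->
  0 < c -> c < Num.sqrt (W (h t)) -> c * enorm (derive1 h t) <= l.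
Proof.
move=> t01 ht c0 ct.
have t01' : 0 <= t <= 1 by move: t01 => /andP[? ?]; rewrite !ltW.
have [d d0 dP] := dist_lipschitz_enorm t01' c0 ct.
rewrite mulrC -ler_pdivlMr// derive1E.
have near01 : \forall k \near (0 : R)^', 0 < k + t < 1.
  have /andP[t0 t1] := t01; near=> k.
  have : `|k| < Num.min t (1 - t) by near: k; apply: dnbhs0_lt; rewrite lt_min t0 subr_gt0.
  by rewrite lt_min !ltr_norml; lra.
apply: (@closed_cvg _ _ (0 : R)^' _
    (fun k => k^-1 *: ((h \o shift t) (k *: 1) - h t))
    [set v | enorm v <= l / c] _ _ _ ht).
  apply: (@closed_comp _ _ (@enorm R N) [set s | s <= l / c]); last exact: closed_le.
  by move=> v _; exact: enorm_continuous.
near=> k => /=.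
rewrite enormZ [k%:A]mulr1 normfV.
have k0 : 0 < `|k| by rewrite normr_gt0; near: k; exact: nbhs_dnbhs_neq.
rewrite ler_pdivrMl// mulrA ler_pdivlMr// mulrC [`|k| * l]mulrC.
have := dP (k + t) t; rewrite addrK subrr normr0; apply => //.
  by have /andP[? ?] : 0 < k + t < 1 by [near: k]; rewrite !ltW.
by near: k; exact: dnbhs0_lt.
Unshelve. all: by end_near. Qed.

(** The bound is trivial where [h] is not differentiable, its derivative being
    [0] by default, and at the wells; elsewhere let [c] increase to the weight
    in [dist_lipschitz_speed]. *)
Lemma dist_lipschitz_integrand t : 0 < t < 1 -> integrand W h t <= l.
Proof.
move=> t01; rewrite /integrand.
have [ht|/derive1_not_derivable ->] := pselect (derivable h t 1); last by rewrite enorm0 mulr0.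
have [->|Wt] := pselect (W (h t) = 0); first by rewrite sqrtr0 mul0r.
have F0 := sqrtW_gt0 W_ge0 Wt.
rewrite leNgt; apply/negP => lFv.
set F := Num.sqrt _ in F0 lFv *; set v := enorm _ in lFv.
have v0 : 0 < v.
  by rewrite -(pmulr_rgt0 _ F0) (le_lt_trans l_ge0 lFv).
have lv : l / v < F by rewrite ltr_pdivrMr.
have lv0 : 0 <= l / v by rewrite divr_ge0// ltW.
(* The midpoint of [l / v] and [F]: still below [F], yet large enough for its
   product with [v] to exceed [l]. *)
have := @dist_lipschitz_speed t ((l / v + F) / 2) t01 ht; rewrite -/v -/F.
have vl : l = l / v * v by rewrite divfK// gt_eqF.
move=> H; have : (l / v + F) / 2 * v <= l by apply: H; lra.
rewrite {2}vl ler_pM2r//; lra.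
Qed.

Lemma dist_lipschitz_energy : (energy W h <= l%:E)%E.
Proof.
apply: energy_le => //; first exact: dist_lipschitz_LipZ.
exact: dist_lipschitz_integrand.
Qed.

End GeodesicEnergy.

(** * Length and the main result *)

Section CurveLengthInf.
Context {R : realType} {N : nat}.
Variable W : 'rV[R]_N -> R.
Hypothesis W_cont : continuous W.

(** Both bounds come from [wdist <= curve_length <= energy]. *)
Lemma inf_curve_length (p q : 'rV[R]_N) :
  ereal_inf [set curve_length W g | g in LipZ_from_to W p q] = wdist W p q.
Proof.
apply/eqP; rewrite eq_le; apply/andP; split.
  apply: le_ereal_inf_tmp => _ [g pqg <-].
  apply: (@le_trans _ _ (curve_length W g)).
    by apply: ereal_inf_lbound; exists g.
  by case: pqg => Zg _ _; exact: curve_length_le_energy.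
apply: le_ereal_inf_tmp => _ [g pqg <-].
exact: wdist_le_curve_length.
Qed.

End CurveLengthInf.

Theorem theorem2p5 (R : realType) (N m : nat) (hN : (2 <= N)%N) (hm : (2 <= m)%N)
    (W : 'rV[R]_N -> R) (W_ge0 : forall x, 0 <= W x) (W_cont : continuous W)
    (well : 'I_m -> 'rV[R]_N) (well_inj : injective well)
    (W_zeros : zero_set W = range well)
    (W_infty : (0 < limf_einf (fun x => (W x)%:E) at_infinity)%E)
    (p q : 'rV[R]_N) (pq : p <> q) :
  exists2 gamma : R -> 'rV[R]_N, LipZ_from_to W p q gamma &
    [/\ curve_length W gamma =
          ereal_inf [set curve_length W g | g in LipZ_from_to W p q],
        ereal_inf [set curve_length W g | g in LipZ_from_to W p q] =
          wdist W p q
      & wdist W p q = energy W gamma].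
Proof.
have [h [hp hq h_lip]] := geodesic W_ge0 W_cont W_zeros W_infty p q.
have Zh : LipZ W h := dist_lipschitz_LipZ W_ge0 W_cont W_zeros h_lip.
have pqh : LipZ_from_to W p q h by split.
have dE : wdist W p q = energy W h.
  apply/eqP; rewrite eq_le wdist_le_energy//= -(distE W_cont).
  exact: (dist_lipschitz_energy W_ge0 W_cont W_zeros h_lip).
exists h => //; rewrite (inf_curve_length W_cont); split=> //.
apply/eqP; rewrite eq_le (wdist_le_curve_length pqh) andbT dE.
exact: curve_length_le_energy.
Qed.
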